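(* There exists a compact and totally disconnected set $A\subset\mathbb{H}$ whose Hausdorff dimension with respect to the Carnot--Carathéodory metric $d_{cc}$ is equal to $3$ and whose complement $\mathbb{H}\setminus A$, equipped with the restriction of $d_{cc}$, is not quasiconvex.
   Context: The Heisenberg group $\mathbb{H}$ is $\mathbb{R}^3$ with the group law $(x,y,t)*(x',y',t') = (x+x',\,y+y',\,t+t'+2(x'y-xy'))$. It carries the left-invariant vector fields $X=\partial_x+2y\,\partial_t$ and $Y=\partial_y-2x\,\partial_t$. An absolutely continuous curve $\gamma$ in $\mathbb{H}$ is horizontal if for almost every $s$ one has $\gamma'(s)=a(s)X+b(s)Y$ (vector fields evaluated at $\gamma(s)$) for some functions $a,b$; its cc-length is $\ell_{cc}(\gamma)=\int\sqrt{a(s)^2+b(s)^2}\,ds$. The Carnot--Carathéodory distance $d_{cc}(p,q)$ is the infimum of the cc-lengths of all horizontal curves joining $p$ to $q$. The topology of $(\mathbb{H},d_{cc})$ is the Euclidean topology of $\mathbb{R}^3$. A metric space $(Z,d)$ is $c$-quasiconvex ($c\ge 1$) if every pair of points $u,v\in Z$ can be joined by a rectifiable curve in $Z$ whose length is at most $c\,d(u,v)$; it is quasiconvex if it is $c$-quasiconvex for some $c\ge1$. *)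

(* Defs.v *)
From mathcomp Require Import all_boot all_order all_algebra.
From mathcomp Require Import all_classical all_reals all_analysis.
From mathcomp Require Import ring.

Set Implicit Arguments.
Unset Strict Implicit.
Unset Printing Implicit Defensive.

Import Order.TTheory GRing.Theory Num.Theory.
Import numFieldNormedType.Exports.

Local Open Scope classical_set_scope.
Local Open Scope ring_scope.

(* Throughout, a distance is a function [d : T -> T -> \bar R]; extended real
   values let [cc_dist] below be a plain infimum, with no value to be chosen
   for an empty set of competing curves. *)

Section curve_length.
Context {R : realType} {T : Type}.
Implicit Types (d : T -> T -> \bar R) (Z : set T) (c : R).
Local Open Scope ereal_scope.

Definition curve_in d Z (a b : R) (g : R -> T) : Prop :=
  forall t, t \in `[a, b] ->
    Z (g t) /\ d (g t) (g u) @[u --> within [set` `[a, b]] (nbhs t)] --> 0.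

Definition curve_length d (a b : R) (g : R -> T) : \bar R :=
  ereal_sup [set \sum_(0 <= n < size s)
                   d (g (nth b (a :: s) n)) (g (nth b (a :: s) n.+1))
            | s in itv_partition a b].

Definition c_quasiconvex d Z c : Prop :=
  (1 <= c)%R /\
  forall u v, Z u -> Z v -> exists (a b : R) (g : R -> T),
    [/\ (a <= b)%R, curve_in d Z a b g, g a = u, g b = v
      & curve_length d a b g < +oo /\ curve_length d a b g <= c%:E * d u v].

Definition quasiconvex d Z : Prop := exists c, c_quasiconvex d Z c.

End curve_length.

Section hausdorff_dimension.
Context {R : realType} {T : Type}.
Implicit Types (d : T -> T -> \bar R) (A U : set T) (s delta : R).
Local Open Scope ereal_scope.

Definition diameter d U : \bar R := ereal_sup [set d p.1 p.2 | p in U `*` U].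

(* The empty set contributes 0 for every [s]; [diameter d set0] is [-oo]. *)
Definition diameter_pow d s U : \bar R :=
  if U == set0 then 0 else diameter d U `^ s.

Definition hausdorff_premeasure d s delta A : \bar R :=
  ereal_inf [set \sum_(i <oo) diameter_pow d s (U i)
            | U in [set U : nat -> set T | A `<=` \bigcup_i U i /\
                      forall i, diameter d (U i) <= delta%:E]].

Definition hausdorff_measure d s A : \bar R :=
  ereal_sup [set hausdorff_premeasure d s delta A
            | delta in [set delta | (0 < delta)%R]].

Definition hausdorff_dim d A : \bar R :=
  ereal_inf [set s%:E | s in [set s | (0 <= s)%R /\ hausdorff_measure d s A = 0]].

End hausdorff_dimension.

Definition absolutely_continuous {R : realType} {V : normedModType R}
    (a b : R) (f : R -> V) : Prop :=
  forall e : R, 0 < e -> exists2 delta : R, 0 < delta &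
    forall (n : nat) (u v : 'I_n -> R),
      (forall i, a <= u i /\ u i <= v i /\ v i <= b) ->
      trivIset setT (fun i => `]u i, v i[%classic) ->
      \sum_(i < n) (v i - u i) < delta ->
      \sum_(i < n) `|f (v i) - f (u i)| < e.

(* The point (x, y, t) is [((x, y), t)]. The product topology on [R * R * R] is
   the Euclidean one, and its (maximum) norm is equivalent to the Euclidean
   norm, so it gives the same derivatives and absolutely continuous curves.
   [cc_dist] induces this topology too. *)
Definition heis (R : realType) : Type := (R * R * R)%type.

Section heisenberg.
Context {R : realType}.
Implicit Types (p q : heis R) (g : R -> heis R) (alpha beta : R -> R).

Definition heis_mul p q : heis R :=
  let: (x, y, t) := p in let: (x', y', t') := q in
  (x + x', y + y', t + t' + 2 * (x' * y - x * y')).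

Definition heisX p : heis R := (1, 0, 2 * p.1.2).
Definition heisY p : heis R := (0, 1, - 2 * p.1.1).

(* The fields are left-invariant: they generate the right translations by the
   two horizontal one-parameter subgroups. *)
Lemma heis_mulX p (s : R) : heis_mul p (s, 0, 0) = p + s *: heisX p.
Proof.
case: p => [[x y] t]; rewrite /heis_mul /heisX /=.
by congr (_, _, _) => /=; rewrite /GRing.scale /=; ring.
Qed.

Lemma heis_mulY p (s : R) : heis_mul p (0, s, 0) = p + s *: heisY p.
Proof.
case: p => [[x y] t]; rewrite /heis_mul /heisY /=.
by congr (_, _, _) => /=; rewrite /GRing.scale /=; ring.
Qed.

Definition horizontal (a b : R) g alpha beta : Prop :=
  absolutely_continuous a b g /\
  {ae (@lebesgue_measure R), forall s, s \in `[a, b] ->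
    is_derive s 1 g (alpha s *: heisX (g s) + beta s *: heisY (g s))}.

Definition cc_length (a b : R) alpha beta : \bar R :=
  \int[@lebesgue_measure R]_(s in `[a, b])
    (Num.sqrt (alpha s ^+ 2 + beta s ^+ 2))%:E.

(* Measurability of the coefficients, which the integral presupposes, excludes
   no curve: they agree almost everywhere with the derivatives of the first two
   coordinates of [g]. *)
Definition cc_dist p q : \bar R :=
  ereal_inf [set l | exists (a b : R) g alpha beta,
    [/\ a <= b, g a = p & g b = q] /\
    [/\ measurable_fun `[a, b] alpha, measurable_fun `[a, b] beta,
        horizontal a b g alpha beta & l = cc_length a b alpha beta]].

End heisenberg.

(* Main.v *)
Require Import Defs.
From mathcomp Require Import all_boot all_order all_algebra.
From mathcomp Require Import all_classical all_reals all_analysis.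
From mathcomp Require Import measurable_realfun ring lra zify.

(* The set consists of thin layers of the planes [x = const], arranged in a Cantor
   scheme: at level [n] each layer of level [n - 1] is replaced by many parallel
   sublayers, cut by thin slits in the [y] direction ([n] even) or the [t]
   direction ([n] odd), the slits of consecutive sublayers being shifted by half a
   period. On a bounded set [x], [y] and [t] are Lipschitz along curves for the cc
   length, so a curve of length at most 1 crossing a layer cannot pass through a
   slit of each of its sublayers: that would force too many displacements by a
   quarter period. Hence it crosses some sublayer without meeting its slits, and,
   inductively, it meets the set. Two points on either side of a layer of level
   [n], at distance about its width and far from all slits, are thus not joined in
   the complement by curves of comparable length.

   The projection to [x] is covered by few very short intervals, and the planes
   [x = const] have cc dimension 3, which bounds the dimension from above. The
   slice [x = 0] contains a product of two sets of positive measure, which bounds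
   it from below. *)

Set Implicit Arguments.
Unset Strict Implicit.
Unset Printing Implicit Defensive.

Import Order.TTheory GRing.Theory Num.Theory.
Import numFieldNormedType.Exports.

Local Open Scope classical_set_scope.
Local Open Scope ring_scope.

(** * Lower bounds for the Carnot-Caratheodory distance *)

Section horizontal_curves.
Context {R : realType}.
Implicit Types (a b s x y : R) (f h : R -> R).
Local Notation mu := (@lebesgue_measure R).

(** Real induction: the supremum of the points satisfying [P] is passed by applying the step across
    it, from a point just below to a point just above. It serves to build finite chains of
    intervals. *)
Lemma interval_induction a b (P : R -> Prop) : a <= b -> P a ->
  (forall s, a <= s <= b -> exists2 r, 0 < r & forall x y,
     a <= x -> s - r < x <= s -> s <= y < s + r -> y <= b -> P x -> P y) ->
  P b.
Proof.
move=> ab Pa step.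
pose S := [set x | a <= x <= b /\ P x].
have Sa : S a by split=> //; rewrite lexx.
have supS : has_sup S by split; [exists a|exists b => x [/andP[]]].
have aS : a <= sup S by apply: sup_upper_bound.
have Sb : sup S <= b by apply: sup_le_ub => // ; [exists a|move=> x [/andP[]]].
have [r r0 Sr] := step (sup S) (introT andP (conj aS Sb)).
have [x [/andP[ax xb] Px] Sx] := sup_adherent r0 supS.
have xS : x <= sup S by apply: sup_upper_bound => //; split=> //; apply/andP.
have [bS|Sb'] := leP b (sup S + r / 2).
  apply: (Sr x b) => //; first by rewrite Sx.
  by rewrite Sb/=; lra.
have : P (sup S + r / 2).
  apply: (Sr x _) => //; [by rewrite Sx|lra|lra].
move=> PS; have : sup S + r / 2 <= sup S.
  by apply: sup_upper_bound => //; split => //; lra.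
lra.
Qed.

Definition chain a x (n : nat) (u v : nat -> R) :=
  (forall i, (i < n)%N -> a <= u i /\ u i <= v i /\ v i <= x) /\
  (forall i j, (i < j < n)%N -> v i <= u j).

(** By real induction, [[x, y]] being appended to the chain exactly when the second alternative
    holds. This splits the increment of [h] into a part of slope at most [e] and a part carried by
    finitely many intervals of total length controlled by [m]. *)
Lemma chain_cover a b f h (m : R -> R) (e : R) : a <= b -> 0 <= e ->
  {homo m : x y / x <= y} ->
  (forall s, a <= s <= b -> exists2 r, 0 < r & forall x y,
     a <= x -> s - r < x <= s -> s <= y < s + r -> y <= b ->
     h y - h x <= e * (y - x) \/
     (y - x <= m y - m x /\ h y - h x <= `|f y - f x|)) ->
  exists n u v, [/\ chain a b n u v,
    \sum_(i < n) (v i - u i) <= m b - m a &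
    h b - h a <= e * (b - a) + \sum_(i < n) `|f (v i) - f (u i)|].
Proof.
move=> ab e0 mm loc.
apply: (@interval_induction a b (fun x => exists n u v, [/\ chain a x n u v,
    \sum_(i < n) (v i - u i) <= m x - m a &
    h x - h a <= e * (x - a) + \sum_(i < n) `|f (v i) - f (u i)|])) => //.
  exists 0%N, (fun=> a), (fun=> a); rewrite !big_ord0 !subrr mulr0 addr0.
  by split => //; split => // i j; rewrite ltn0 andbF.
move=> s /loc[r r0 H]; exists r => // x y ax sx sy yb.
move=> [n [u [v [[c1 c2] c3 c4]]]].
have xy : x <= y by move/andP: sx => [_ /le_trans]; apply; case/andP: sy.
have [K|[K1 K2]] := H x y ax sx sy yb.
  exists n, u, v; split.
  - split=> // i /c1 [? [? ?]]; split=> //; split=> //.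
    exact: le_trans xy.
  - by apply: (le_trans c3); rewrite lerB// mm.
  - nra.
pose u' i := if (i < n)%N then u i else x.
pose v' i := if (i < n)%N then v i else y.
have u'E (i : 'I_n) : u' i = u i by rewrite /u' ltn_ord.
have v'E (i : 'I_n) : v' i = v i by rewrite /v' ltn_ord.
have u'n : u' n = x by rewrite /u' ltnn.
have v'n : v' n = y by rewrite /v' ltnn.
exists n.+1, u', v'; split.
- split=> [i|i j].
    rewrite ltnS leq_eqVlt => /orP[/eqP ->|]; first by rewrite u'n v'n.
    move=> ni; rewrite /u' /v' ni; have [? [? ?]] := c1 _ ni.
    by split=> //; split=> //; exact: le_trans xy.
  rewrite ltnS => /andP[ij jn].
  rewrite /v' (leq_trans ij jn).
  move: jn; rewrite leq_eqVlt => /orP[/eqP jn|jn].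
    by rewrite /u' jn ltnn; have [? []] := c1 i (leq_trans ij (eq_leq jn)).
  by rewrite /u' jn c2 // ij.
- rewrite big_ord_recr /= u'n v'n.
  under eq_bigr do rewrite u'E v'E.
  lra.
- rewrite big_ord_recr /= u'n v'n.
  under eq_bigr do rewrite u'E v'E.
  have : 0 <= e * (y - x) by rewrite mulr_ge0// subr_ge0.
  lra.
Qed.

Lemma chain_trivIset a x n (u v : nat -> R) : chain a x n u v ->
  trivIset setT (fun i : 'I_n => `]u i, v i[%classic).
Proof.
move=> [_ c2] i j _ _ [z [/=]]; rewrite !in_itv/= => /andP[uz zv] /andP[uz' zv'].
apply/val_inj => /=; have [ij|ij|//] := ltngtP i j.
- exfalso; have := c2 i j; rewrite ij ltn_ord => /(_ isT); lra.
- exfalso; have := c2 j i; rewrite ij ltn_ord => /(_ isT); lra.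
Qed.

(** The difference quotients on the two sides of [s] are both at most [e], and the two increments
    add up. *)
Lemma derive1_le_increments h s (k e : R) : is_derive s 1 h k -> k <= 0 -> 0 < e ->
  exists2 r, 0 < r & forall x y, s - r < x <= s -> s <= y < s + r ->
    h y - h x <= e * (y - x).
Proof.
move=> [/cvg_ex[l hl] dk] k0 e0.
have lk : l = k by rewrite -dk /derive; apply/esym/cvg_lim.
move: hl; rewrite lk => /cvgrPdist_lt /(_ _ e0)[r /= r0 H].
exists r => // x y /andP[sx xs] /andP[sy ys].
have key z : `|z - s| < r -> z != s -> (h z - h s) / (z - s) <= e.
  move=> zr zs; have /= := H (z - s).
  rewrite sub0r normrN subr_eq0 => /(_ zr zs).
  rewrite -[_ *: 1]/(_ * 1) mulr1 subrK.
  rewrite ltr_norml => /andP[+ _].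
  rewrite /GRing.scale/= mulrC; lra.
have hy : h y - h s <= e * (y - s).
  have [->|ys'] := eqVneq y s; first by rewrite !subrr mulr0.
  have y0 : 0 < y - s by rewrite subr_gt0 lt_neqAle eq_sym ys'.
  by rewrite -ler_pdivrMr// key// ger0_norm// ?ltrBlDl// ltW.
have hx : h s - h x <= e * (s - x).
  have [->|xs'] := eqVneq x s; first by rewrite !subrr mulr0.
  have x0 : 0 < s - x by rewrite subr_gt0 lt_neqAle xs'.
  rewrite -ler_pdivrMr//.
  rewrite (_ : _ / _ = (h x - h s) / (x - s)); last first.
    by rewrite -(opprB x s) -(opprB (h x)) invrN mulrNN.
  by rewrite key// distrC ger0_norm ?ltW// ltrBlDl -ltrBlDr.
lra.
Qed.

Lemma derive1_is_derive f s (k : R) : derivable f s 1 -> derive1 f s = k ->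
  is_derive s 1 f k.
Proof. by move=> df <-; split; [exact: df|rewrite derive1E]. Qed.

(** With [F] the integral of [phi], the difference [f - F] has a nonpositive derivative off a null
    set [N]. An open [V] of small measure containing [N] absorbs the bad points: there absolute
    continuity bounds the increments of [f], and [F] is nondecreasing; elsewhere the slope is at
    most [e]. *)
Lemma increment_le_integral a b f (f' phi : R -> R) : a <= b ->
  absolutely_continuous a b (f : R -> R^o) ->
  measurable_fun `[a, b] phi -> (forall s, s \in `[a, b] -> 0 <= phi s) ->
  {ae mu, forall s, s \in `[a, b] -> is_derive s 1 f (f' s) /\ f' s <= phi s} ->
  ((f b - f a)%:E <= \int[mu]_(s in `[a, b]) (phi s)%:E)%E.
Proof.
move=> ab acf mphi phi0 aef.
have int0 : (0 <= \int[mu]_(s in `[a, b]) (phi s)%:E)%E.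
  by apply: integral_ge0 => s sab; rewrite lee_fin phi0.
have [->|intfin] := eqVneq (\int[mu]_(s in `[a, b]) (phi s)%:E)%E +oo%E.
  by rewrite leey.
have iphi : mu.-integrable `[a, b] (EFin \o phi).
  apply/integrableP; split; first exact/measurable_EFinP.
  rewrite (_ : integral _ _ _ = (\int[mu]_(s in `[a, b]) (phi s)%:E)%E).
    by rewrite ltey.
  by apply: eq_integral => s; rewrite inE => sab /=; rewrite ger0_norm// phi0.
pose p := phi \_ `[a, b].
have ip : mu.-integrable setT (EFin \o p).
  by rewrite /p -restrict_EFin -integrable_mkcond.
have p0 s : 0 <= p s by rewrite /p patchE; case: ifPn => // /set_mem; exact: phi0.
have ipy (y : R) : mu.-integrable [set` `[a, y]] (EFin \o p).
  by apply: integrableS ip.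
pose F x := (\int[mu]_(t in [set` Interval (BLeft a) (BRight x)]) p t)%R.
have aeF : {ae mu, forall x, (BLeft a < BRight x)%E -> derivable F x 1 /\ derive1 F x = p x}.
  apply: FTC1 => //; exact: integrable_locally.
have Fm : {homo F : x y / x <= y}.
  move=> x y xy; rewrite /F /Rintegral fine_le//.
  - by apply: integrable_fin_num.
  - by apply: integrable_fin_num.
  - apply: ge0_subset_integral => //=.
    - by case/integrableP: (ipy y).
    - by move=> z _; rewrite lee_fin.
    - by move=> z; rewrite /= !in_itv/= => /andP[-> /=] /le_trans; exact.
have [N [mN N0 HN]] : mu.-negligible (~` [set s | s \in `[a, b] ->
    exists2 k, is_derive s 1 (f - F) k & k <= 0]).
  have a0 : mu.-negligible [set a] by apply/negligibleP => //; exact: lebesgue_measure_set1.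
  apply: (negligibleS _ (negligibleU a0 (negligibleU aef aeF))) => s /= sN.
  apply: contrapT => /not_orP[sa /not_orP[/contrapT K1 /contrapT K2]].
  apply: sN => sab.
  have [df fp] := K1 sab.
  have [|dF Fs] := K2.
    move: sab; rewrite in_itv/= lte_fin => /andP[].
    by rewrite le_eqVlt => /predU1P[/esym|].
  have iF : is_derive s 1 F (p s) by exact: derive1_is_derive.
  exists (f' s - p s); first exact: is_deriveB.
  by rewrite subr_le0 /p patchE mem_set.
have FaE : F a = 0.
  rewrite /F /Rintegral set_itv1 integral_set1//.
have FbE : (F b)%:E = (\int[mu]_(s in `[a, b]) (phi s)%:E)%E.
  rewrite /F /Rintegral fineK; last exact: integrable_fin_num.
  by apply: eq_integral => s sab; rewrite /p patchE sab.
rewrite -FbE lee_fin -[F b]subr0 -FaE.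
suff H (e : R) : 0 < e -> (f b - F b) - (f a - F a) <= e * (b - a) + e.
  apply/ler_addgt0Pr => e e0; rewrite -lerBlDl.
  have ba1 : 0 < b - a + 1 by rewrite ltr_wpDl// subr_ge0.
  have := H (e / (b - a + 1)); rewrite divr_gt0// => /(_ isT) K.
  apply: (@le_trans _ _ (f b - F b - (f a - F a))); first by lra.
  apply: (le_trans K).
  by rewrite -[X in _ + X]mulr1 -mulrDr divfK ?gt_eqF.
move=> e0.
have [d d0 Hd] := acf e e0.
have Noo : (mu N < +oo)%E by rewrite N0 ltry.
have [V [oV NV Vd]] := lebesgue_regularity_outer mN Noo d0.
have mV : measurable V by exact: open_measurable.
have muV : (mu V < d%:E)%E.
  rewrite -(setDUK NV) (le_lt_trans (measureU2 _ _ _))//; first exact: measurableD.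
  by apply: le_lt_trans Vd; rewrite [X in (X + _)%E](_ : _ = 0%E) ?add0e.
have finV x : mu (V `&` `[a, x]) \is a fin_num.
  rewrite ge0_fin_numE// (le_lt_trans _ (lt_trans muV (ltry _)))//.
  by apply: le_measure; rewrite ?inE//; exact: measurableI.
(* This function grows by the full length of every interval contained in [V]. *)
pose m x := fine (mu (V `&` `[a, x])).
have mm : {homo m : x y / x <= y}.
  move=> x y xy; rewrite /m fine_le// le_measure ?inE//; [exact: measurableI..|].
  apply: setIS => z /=; rewrite !in_itv/= => /andP[-> /=] /le_trans; exact.
have [] := @chain_cover a b f (f - F) m e ab (ltW e0) mm.
  move=> s sab.
  have [sN|sN] := pselect (N s).
    have [r /= r0 Vr] : nbhs s V by apply: open_nbhs_nbhs; split => //; exact: NV.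
    exists r => // x y ax /andP[sx xs] /andP[sy ys] yb; right.
    have xy : x <= y by exact: le_trans sy.
    split.
      rewrite -lee_fin (_ : (y - x)%:E = mu `]x, y]); last first.
        rewrite lebesgue_measure_itv/= lte_fin; case: ltP => [_|yx].
          by rewrite EFinB.
        by rewrite (le_anti (introT andP (conj xy yx))) subrr.
      rewrite EFinB !fineK// leeBrDr//.
      rewrite -[leLHS]measureU//; last first.
      - rewrite -subset0 => z /= [] ; rewrite !in_itv/= => /andP[xz _] [_ /andP[_ zx]]; lra.
      - exact: measurableI.
      apply: le_measure; rewrite ?inE//.
      - by apply: measurableU => //; exact: measurableI.
      - exact: measurableI.
      move=> z /= [|[Vz]]; rewrite !in_itv/= => /andP[z1 z2]; split => //; last first.
      - by rewrite z1 (le_trans z2).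
      - by rewrite z2 andbT (le_trans ax (ltW _)).
      apply: Vr => /=; rewrite ltr_norml; lra.
    rewrite !fctE (le_trans _ (ler_norm _))//.
    have := Fm _ _ xy; lra.
  have [k dk k0] : exists2 k, is_derive s 1 (f - F) k & k <= 0.
    by have : ~ N s by []; move/(contra_notP (HN s)) => /=; apply; rewrite in_itv.
  have [r r0 Hr] := derive1_le_increments dk k0 e0.
  by exists r => // x y ax xs sy yb; left; exact: Hr.
move=> n [u [v [c Hm Hh]]].
rewrite (le_trans Hh)// lerD2l ltW// Hd//.
- move=> i; have [c1 _] := c; exact: c1.
- exact: chain_trivIset c.
- rewrite (le_lt_trans Hm)// -lte_fin (le_lt_trans _ muV)//.
  rewrite (@le_trans _ _ (m b)%:E)//.
    by rewrite lee_fin lerBlDr lerDl /m fine_ge0.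
  by rewrite fineK//; apply: le_measure; rewrite ?inE//; exact: measurableI.
Qed.

(** * Linear functionals along horizontal curves *)

Implicit Types (p q : heis R) (g : R -> heis R) (alpha beta : R -> R).

Definition heis_linear (c1 c2 c3 : R) p : R := c1 * p.1.1 + c2 * p.1.2 + c3 * p.2.

Lemma heis_coord_continuous : [/\ continuous (fun p : heis R => p.1.1 : R),
  continuous (fun p : heis R => p.1.2 : R) & continuous (fun p : heis R => p.2 : R)].
Proof.
split=> p; last exact: cvg_snd.
- by apply: (@continuous_comp _ _ _ fst fst); exact: cvg_fst.
- by apply: (@continuous_comp _ _ _ fst snd); [exact: cvg_fst|exact: cvg_snd].
Qed.

Lemma heis_linear_continuous c1 c2 c3 : continuous (heis_linear c1 c2 c3).
Proof.
have [cx cy ct] := heis_coord_continuous.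
move=> p; rewrite /heis_linear.
apply: cvgD; last by apply: cvgM; [exact: cvg_cst|exact: ct].
by apply: cvgD; apply: cvgM => //; [exact: cvg_cst|exact: cx|exact: cvg_cst|exact: cy].
Qed.

Lemma heis_linear_is_derive c1 c2 c3 g s (v : heis R) : is_derive s 1 g v ->
  is_derive s 1 (heis_linear c1 c2 c3 \o g) (heis_linear c1 c2 c3 v).
Proof.
move=> [/cvg_ex[l hl] dk].
have lv : l = v by rewrite -dk /derive; apply/esym/cvg_lim.
rewrite lv in hl.
have H : h^-1 *: ((heis_linear c1 c2 c3 \o g) (h *: 1 + s) - (heis_linear c1 c2 c3 \o g) s)
      @[h --> 0^'] --> heis_linear c1 c2 c3 v.
  have := cvg_comp _ _ hl (@heis_linear_continuous c1 c2 c3 v).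
  apply: cvg_trans; apply: near_eq_cvg; near=> h.
  rewrite /heis_linear /= /GRing.scale/=; ring.
split; first by apply/cvg_ex; exists (heis_linear c1 c2 c3 v).
by rewrite /derive; apply/cvg_lim.
Unshelve. all: by end_near. Qed.

Lemma heis_linear_norm c1 c2 c3 p :
  `|heis_linear c1 c2 c3 p| <= (`|c1| + `|c2| + `|c3|) * `|p|.
Proof.
have p1 : `|p.1.1| <= `|p| by rewrite !prod_normE !le_max lexx.
have p2 : `|p.1.2| <= `|p| by rewrite !prod_normE !le_max lexx orbT.
have p3 : `|p.2| <= `|p| by rewrite !prod_normE !le_max lexx orbT.
rewrite /heis_linear (le_trans (ler_normD _ _))// mulrDl lerD//; last first.
  by rewrite normrM ler_wpM2l.
by rewrite (le_trans (ler_normD _ _))// mulrDl lerD// normrM ler_wpM2l.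
Qed.

Lemma heis_linear_ac c1 c2 c3 a b g : absolutely_continuous a b g ->
  absolutely_continuous a b (heis_linear c1 c2 c3 \o g : R -> R^o).
Proof.
move=> acg e e0; pose C := `|c1| + `|c2| + `|c3| + 1.
have C0 : 0 < C by rewrite ltr_wpDl.
have [d d0 H] := acg (e / C) (divr_gt0 e0 C0).
exists d => // n u v uv tuv suv.
apply: (@le_lt_trans _ _ (\sum_(i < n) C * `|g (v i) - g (u i)|)).
  apply: ler_sum => i _ /=.
  rewrite (_ : heis_linear _ _ _ _ - _ = heis_linear c1 c2 c3 (g (v i) - g (u i))).
    by rewrite (le_trans (heis_linear_norm _ _ _ _))// ler_wpM2r// lerDl.
  rewrite /heis_linear /=; ring.
by rewrite -mulr_sumr mulrC -ltr_pdivlMr// H.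
Qed.

Lemma horizontal_sub a b s g alpha beta : s <= b ->
  horizontal a b g alpha beta -> horizontal a s g alpha beta.
Proof.
move=> sb [acg dg]; split.
  move=> e e0; have [d d0 H] := acg e e0.
  exists d => // n u v uv tuv suv; apply: H => // i.
  by have [? [? ?]] := uv i; split=> //; split=> //; exact: le_trans sb.
move: dg; apply: filterS; first exact: (ae_filter_ringOfSetsType mu).
move=> x H xs; apply: H.
by move: xs; rewrite !in_itv/= => /andP[-> /=] /le_trans; apply.
Qed.

Definition speed alpha beta s := Num.sqrt (alpha s ^+ 2 + beta s ^+ 2).

Lemma measurable_speed (D : set R) alpha beta : measurable_fun D alpha ->
  measurable_fun D beta -> measurable_fun D (speed alpha beta).
Proof.
move=> ma mb; rewrite /speed.
apply: (@measurableT_comp _ _ _ _ _ _ (@Num.sqrt R)).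
  apply: continuous_measurable_fun; exact: sqrt_continuous.
by apply: measurable_funD; apply: measurable_funX.
Qed.

Lemma cc_length_sub a b s alpha beta : s <= b ->
  measurable_fun `[a, b] alpha -> measurable_fun `[a, b] beta ->
  (cc_length a s alpha beta <= cc_length a b alpha beta)%E.
Proof.
move=> sb ma mb; apply: ge0_subset_integral => //=.
- by apply/measurable_EFinP; exact: measurable_speed.
- by move=> z; rewrite /= !in_itv/= => /andP[-> /=] /le_trans; apply.
Qed.

(** The left-hand side of the last hypothesis is the derivative of the functional along the curve,
    since [X] and [Y] have vertical components [2 y] and [- 2 x]. *)
Lemma heis_linear_increment_le c1 c2 c3 (m D : R) a b g alpha beta : a <= b ->
  horizontal a b g alpha beta ->
  measurable_fun `[a, b] alpha -> measurable_fun `[a, b] beta -> 0 <= m ->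
  (cc_length a b alpha beta <= D%:E)%E ->
  (forall s, a <= s <= b ->
     (c1 + 2 * c3 * (g s).1.2) * alpha s + (c2 - 2 * c3 * (g s).1.1) * beta s
       <= m * speed alpha beta s) ->
  heis_linear c1 c2 c3 (g b) - heis_linear c1 c2 c3 (g a) <= m * D.
Proof.
move=> ab [acg dg] ma mb m0 lD H.
rewrite -lee_fin.
pose f' s := heis_linear c1 c2 c3 (alpha s *: heisX (g s) + beta s *: heisY (g s)).
apply: (@le_trans _ _ (\int[mu]_(s in `[a, b]) (m * speed alpha beta s)%:E)%E).
  apply: (@increment_le_integral a b (heis_linear c1 c2 c3 \o g) f') => //.
  - exact: heis_linear_ac.
  - by apply: measurable_funM => //; exact: measurable_speed.
  - by move=> s _; rewrite mulr_ge0// sqrtr_ge0.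
  - move: dg; apply: filterS; first exact: (ae_filter_ringOfSetsType mu).
    move=> s Hs sab; split; first exact: heis_linear_is_derive (Hs sab).
    rewrite (le_trans _ (H s sab))// /f' /heis_linear /=.
    by rewrite /GRing.scale/=; lra.
under eq_integral do rewrite EFinM.
rewrite ge0_integralZl//.
- by rewrite EFinM lee_wpmul2l ?lee_fin.
- by apply/measurable_EFinP; exact: measurable_speed.
- by move=> s _; rewrite lee_fin sqrtr_ge0.
Qed.

Lemma cauchy_schwarz2 (u v x y : R) : u * x + v * y <=
  Num.sqrt (u ^+ 2 + v ^+ 2) * Num.sqrt (x ^+ 2 + y ^+ 2).
Proof.
rewrite -sqrtrM; last by rewrite addr_ge0// sqr_ge0.
apply: (le_trans (ler_norm _)); rewrite -sqrtr_sqr ler_wsqrtr//.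
have := sqr_ge0 (u * y - v * x); nra.
Qed.

(** The third quantity is the vertical coordinate of the inverse of [p] times [q]. Along a curve
    from [p] it grows at a rate of at most [2 * sqrt (X ^ 2 + Y ^ 2)] times the speed, where the
    horizontal displacements [X] and [Y] are themselves at most [D]; hence the quadratic bound. *)
Lemma cc_dist_coord (p q : heis R) (D : R) : (cc_dist p q < D%:E)%E ->
  [/\ `|q.1.1 - p.1.1| <= D, `|q.1.2 - p.1.2| <= D &
      `|q.2 - p.2 - 2 * p.1.2 * (q.1.1 - p.1.1) + 2 * p.1.1 * (q.1.2 - p.1.2)|
         <= 4 * D ^+ 2].
Proof.
move=> /ereal_inf_lt[_ [a [b [g [alpha [beta [[ab gp gq] [ma mb hor ->]]]]]]]] lD.
have D0 : 0 <= D.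
  rewrite -lee_fin (le_trans _ (ltW lD))//.
  by apply: integral_ge0 => s _; rewrite lee_fin sqrtr_ge0.
have sp s : 0 <= speed alpha beta s by exact: sqrtr_ge0.
have xy s : a <= s <= b ->
    `|(g s).1.1 - p.1.1| <= D /\ `|(g s).1.2 - p.1.2| <= D.
  move=> /andP[as' sb].
  have hs := horizontal_sub sb hor.
  have sub : `[a, s]%classic `<=` `[a, b]%classic.
    by move=> z; rewrite /= !in_itv/= => /andP[-> /=] /le_trans; apply.
  have mas : measurable_fun `[a, s] alpha by exact: measurable_funS ma.
  have mbs : measurable_fun `[a, s] beta by exact: measurable_funS mb.
  have ls := le_trans (cc_length_sub sb ma mb) (ltW lD).
  have K c1 c2 : c1 ^+ 2 + c2 ^+ 2 = 1 ->
      c1 * ((g s).1.1 - p.1.1) + c2 * ((g s).1.2 - p.1.2) <= D.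
    move=> c12.
    have := @heis_linear_increment_le c1 c2 0 1 D a s g alpha beta as' hs mas mbs ler01 ls.
    move=> H; apply: (le_trans _ (le_trans (H _) _)); last by rewrite mul1r.
      by rewrite /heis_linear gp; lra.
    move=> r _; rewrite mulr0 !mul0r addr0 subr0 (le_trans (cauchy_schwarz2 _ _ _ _))//.
    by rewrite c12 sqrtr1.
  have := K 1 0; have := K (-1) 0; have := K 0 1; have := K 0 (-1).
  rewrite !ler_norml; lra.
have K c3 : c3 ^+ 2 = 1 ->
   c3 * (q.2 - p.2 - 2 * p.1.2 * (q.1.1 - p.1.1) + 2 * p.1.1 * (q.1.2 - p.1.2))
         <= 4 * D ^+ 2.
  move=> c31.
  have D4 : 0 <= 4 * D by lra.
  have := @heis_linear_increment_le (- c3 * 2 * p.1.2) (c3 * 2 * p.1.1) c3 (4 * D) D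
    a b g alpha beta ab hor ma mb D4 (ltW lD).
  rewrite /heis_linear gp gq => H.
  apply: (le_trans _ (le_trans (H _) _)); [lra| |lra].
  move=> s sab; apply: (le_trans (cauchy_schwarz2 _ _ _ _)).
  rewrite ler_wpM2r//.
  have [] := xy s sab; set X := _ - p.1.1; set Y := _ - p.1.2 => XD YD.
  rewrite (_ : _ ^+ 2 + _ = 4 * (X ^+ 2 + Y ^+ 2)); last first.
    transitivity (4 * c3 ^+ 2 * (X ^+ 2 + Y ^+ 2)); last by rewrite c31 mulr1.
    by rewrite /X /Y; ring.
  rewrite -[leRHS]ger0_norm// -sqrtr_sqr ler_wsqrtr//.
  have : X ^+ 2 <= D ^+ 2 by rewrite -real_normK ?num_real// ler_sqr ?nnegrE.
  have : Y ^+ 2 <= D ^+ 2 by rewrite -real_normK ?num_real// ler_sqr ?nnegrE.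
  have := sqr_ge0 D; nra.
have [] := xy b; first by rewrite lexx ab.
rewrite gq => -> ->; split=> //.
have := K 1; have := K (-1).
rewrite ler_norml; lra.
Qed.
Lemma cc_dist_ge0 (p q : heis R) : (0 <= cc_dist p q)%E.
Proof.
apply: le_ereal_inf_tmp => _ [? [? [? [? [? [_ [_ _ _ ->]]]]]]].
by apply: integral_ge0 => x _; rewrite lee_fin sqrtr_ge0.
Qed.
End horizontal_curves.

(** * Upper bounds for the Carnot-Caratheodory distance *)

Section explicit_horizontal_curves.
Context {R : realType}.
Local Notation mu := (@lebesgue_measure R).
Implicit Types (P X Y T : {poly R}) (p q : heis R).

Lemma poly_bounded01 P : exists2 C : R, 0 <= C & forall s : R, 0 <= s <= 1 -> `|P.[s]| <= C.
Proof.
elim/poly_ind: P => [|P c [C C0 H]].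
  by exists 0 => // s _; rewrite horner0 normr0.
exists (C + `|c|); first by rewrite addr_ge0.
move=> s s01; rewrite !hornerE (le_trans (ler_normD _ _))// lerD2r normrM.
have /andP[s0 s1] := s01.
by rewrite -[leRHS]mulr1 ler_pM// ?H// ger0_norm.
Qed.

Lemma poly_lipschitz01 P : exists2 C : R, 0 <= C &
  forall u v : R, 0 <= u -> u <= v -> v <= 1 -> `|P.[v] - P.[u]| <= C * (v - u).
Proof.
have [C C0 H] := poly_bounded01 P^`().
exists C => // u v u0 uv v1.
have [||c cuv ->] := @MVT_segment R (horner P) (horner P^`()) u v.
- exact: uv.
- apply: derivable_within_continuous => x _; exact: derivable_horner.
move: cuv; rewrite in_itv/= => /andP[uc cv].
rewrite normrM [`|v - u|]ger0_norm ?subr_ge0// ler_wpM2r ?subr_ge0// H//.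
by rewrite (le_trans u0 uc) (le_trans cv v1).
Qed.

Lemma poly_heis_is_derive X Y T (s : R) :
  is_derive s 1 (fun s : R => (X.[s], Y.[s], T.[s]) : heis R)
    ((X^`().[s], Y^`().[s], T^`().[s]) : heis R).
Proof.
have H P : h^-1 *: (P.[h *: 1 + s] - P.[s]) @[h --> 0^'] --> P^`().[s].
  have [/cvg_ex[l hl] dk] := is_derive_poly P s.
  have lv : l = P^`().[s] by rewrite -dk /derive; apply/esym/cvg_lim.
  by rewrite -lv.
pose g (s : R) : heis R := (X.[s], Y.[s], T.[s]).
pose v : heis R := (X^`().[s], Y^`().[s], T^`().[s]).
have K : h^-1 *: (g (h *: 1 + s) - g s) @[h --> 0^'] --> v.
  exact: (cvg_pair (cvg_pair (H X) (H Y)) (H T)).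
split; first by apply/cvg_ex; exists v; exact: K.
by rewrite /derive; apply/cvg_lim; [|exact: K].
Qed.

(** The hypothesis is the contact equation [t' = 2 (y x' - x y')]. Polynomial curves are enough for
    the upper bounds on the distance, and for them it can be checked by algebra. *)
Lemma poly_horizontal X Y T :
  (forall s : R, T^`().[s] = 2 * (Y.[s] * X^`().[s] - X.[s] * Y^`().[s])) ->
  horizontal 0 1 (fun s : R => (X.[s], Y.[s], T.[s]) : heis R)
    (horner X^`()) (horner Y^`()).
Proof.
move=> dT; split.
- have [CX CX0 HX] := poly_lipschitz01 X.
  have [CY CY0 HY] := poly_lipschitz01 Y.
  have [CT CT0 HT] := poly_lipschitz01 T.
  move=> e e0; pose C := CX + CY + CT + 1.
  have C0 : 0 < C by rewrite /C; lra.
  exists (e / C); first exact: divr_gt0.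
  move=> n u v uv tuv suv.
  apply: (@le_lt_trans _ _ (\sum_(i < n) C * (v i - u i))); last first.
    by rewrite -mulr_sumr mulrC -ltr_pdivlMr.
  apply: ler_sum => i _.
  have [u0 [uv' v1]] := uv i.
  have d0 : 0 <= v i - u i by rewrite subr_ge0.
  rewrite !prod_normE /= !ge_max -andbA; apply/and3P; split.
  + by rewrite (le_trans (HX _ _ u0 uv' v1))// ler_wpM2r// /C; lra.
  + by rewrite (le_trans (HY _ _ u0 uv' v1))// ler_wpM2r// /C; lra.
  + by rewrite (le_trans (HT _ _ u0 uv' v1))// ler_wpM2r// /C; lra.
- apply: aeW => s _.
  apply: is_derive_eq; first exact: poly_heis_is_derive.
  rewrite dT /heisX /heisY /GRing.scale /=.
  by congr (_, _, _) => /=; rewrite /GRing.scale/=; ring.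
Qed.

Lemma poly_cc_dist_le X Y T (S : R) :
  (forall s : R, T^`().[s] = 2 * (Y.[s] * X^`().[s] - X.[s] * Y^`().[s])) ->
  (forall s : R, 0 <= s <= 1 -> `|X^`().[s]| + `|Y^`().[s]| <= S) ->
  (cc_dist (X.[0], Y.[0], T.[0]) (X.[1], Y.[1], T.[1]) <= S%:E)%E.
Proof.
move=> dT HS.
have mpoly (P : {poly R}) (D : set R) : measurable_fun D (horner P).
  apply: (measurable_funS measurableT) => //.
  apply: continuous_measurable_fun => s.
  by apply/differentiable_continuous/derivable1_diffP; exact: derivable_horner.
apply: (@le_trans _ _ (cc_length 0 1 (horner X^`()) (horner Y^`()))).
  apply: ereal_inf_lbound; exists 0, 1, (fun s : R => (X.[s], Y.[s], T.[s]) : heis R).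
  exists (horner X^`()), (horner Y^`()); split; first by split.
  by split => //; exact: poly_horizontal.
rewrite /cc_length.
apply: (@le_trans _ _ (\int[mu]_(s in `[0%R, 1%R]) (cst S%:E) s)%E).
  apply: ge0_le_integral => //=.
  - by apply/measurable_EFinP; apply: measurable_speed; exact: mpoly.
  - move=> s; rewrite in_itv/= => s01; rewrite lee_fin (le_trans _ (HS s s01))//.
    rewrite -[leRHS]ger0_norm ?addr_ge0// -sqrtr_sqr ler_wsqrtr//.
    rewrite sqrrD !real_normK ?num_real// lerD2r lerDl.
    by rewrite mulrn_wge0// mulr_ge0.
rewrite integral_cst//= lebesgue_measure_itv/= lte_fin ltr01.
by rewrite sube0 mule1.
Qed.

(* With [w = s (1 - s)], the bumps [w (1 - 2 s)] and [w - 5 w ^ 2] have mean zero,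
   so that adding [A] times the first and [B] times the second to the two
   coordinates of a segment only adds [2 A B / 35] to the last coordinate of the
   end point of its horizontal lift. *)
Lemma cc_dist_bump_le (x y t dx dy A B : R) :
  (cc_dist (x, y, t) (x + dx, y + dy, t + 2 * (y * dx - x * dy) + 2 / 35 * (A * B))%R
    <= (`|dx| + `|dy| + `|A| + 2 * `|B|)%:E)%E.
Proof.
(* [IU] and [IV] are primitives of [U] and [V], and [Z] is one of
   [V U' - U V' = 3 w ^ 2 - 10 w ^ 3]. All five vanish at 0 and all but [Z] at 1, where [Z] equals
   1/35. [T] is the resulting primitive of [2 (Y X' - X Y')]. *)
pose U : {poly R} := 'X * (1 - 'X) * (1 - 2%:P * 'X).
pose V : {poly R} := 'X * (1 - 'X) - 5%:P * ('X * (1 - 'X)) ^+ 2.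
pose IU : {poly R} := (2^-1)%:P * ('X * (1 - 'X)) ^+ 2.
pose IV : {poly R} := (2^-1)%:P * 'X^2 - 2%:P * 'X^3 + (5 / 2)%:P * 'X^4 - 'X^5.
pose Z : {poly R} := 'X^3 - 4%:P * 'X^4 + (33 / 5)%:P * 'X^5 - 5%:P * 'X^6
  + (10 / 7)%:P * 'X^7.
pose X := x%:P + dx%:P * 'X + A%:P * U.
pose Y := y%:P + dy%:P * 'X + B%:P * V.
pose T := t%:P + 2%:P * ((y * dx - x * dy)%:P * 'X + (y * A)%:P * U - (x * B)%:P * V
  + (A * dy)%:P * ('X * U - 2%:P * IU) + (B * dx)%:P * (2%:P * IV - 'X * V)
  + (A * B)%:P * Z).
have horner1 (z : R) : (1 : {poly R}).[z] = 1 by rewrite hornerE.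
have evalE := (hornerD, hornerN, hornerM, hornerX, hornerC, horner_exp, horner1, hornerMn).
have dX (s : R) : X^`().[s] = dx + A * (1 - 6 * (s * (1 - s))).
  by rewrite /X /U !poly.derivE !evalE; ring.
have dY (s : R) : Y^`().[s] = dy + B * ((1 - 2 * s) * (1 - 10 * (s * (1 - s)))).
  by rewrite /Y /V !poly.derivE !evalE; ring.
have dT (s : R) : T^`().[s] = 2 * (Y.[s] * X^`().[s] - X.[s] * Y^`().[s]).
  rewrite dX dY /T /X /Y /U /V /IU /IV /Z !poly.derivE !evalE {dX dY evalE horner1 X Y T U V IU IV Z}.
  by field.
have X0 : X.[0] = x by rewrite /X /U !evalE; ring.
have Y0 : Y.[0] = y by rewrite /Y /V !evalE; ring.
have T0 : T.[0] = t by rewrite /T /U /V /IU /IV /Z !evalE; field.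
have X1 : X.[1] = x + dx by rewrite /X /U !evalE; ring.
have Y1 : Y.[1] = y + dy by rewrite /Y /V !evalE; ring.
have T1 : T.[1] = t + 2 * (y * dx - x * dy) + 2 / 35 * (A * B).
  by rewrite /T /U /V /IU /IV /Z !evalE; field.
rewrite -X1 -Y1 -T1 -[in X in cc_dist X]X0 -[in X in cc_dist X]Y0 -[in X in cc_dist X]T0.
apply: poly_cc_dist_le => // s /andP[s0 s1].
rewrite dX dY.
have w0 : 0 <= s * (1 - s) by nra.
have w1 : s * (1 - s) <= 1 / 4 by have := sqr_ge0 (s - 1 / 2); nra.
have nU : `|1 - 6 * (s * (1 - s))| <= 1 by rewrite ler_norml; lra.
have nV : `|(1 - 2 * s) * (1 - 10 * (s * (1 - s)))| <= 2.
  rewrite normrM -[2]mul1r ler_pM// ler_norml; lra.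
have : `|A * (1 - 6 * (s * (1 - s)))| <= `|A|.
  by rewrite normrM ler_piMr.
have : `|B * ((1 - 2 * s) * (1 - 10 * (s * (1 - s))))| <= 2 * `|B|.
  by rewrite normrM [leRHS]mulrC ler_wpM2l.
have := ler_normD dx (A * (1 - 6 * (s * (1 - s)))).
have := ler_normD dy (B * ((1 - 2 * s) * (1 - 10 * (s * (1 - s))))).
lra.
Qed.

(** The bumps [A = k] and [B = sg sigma * k], with [k] such that [2 / 35 * k ^ 2] is the absolute
    value of [sigma], produce the vertical displacement that the lifted segment misses. As [k] is at
    most 5 times the root of that absolute value, [3 * k] accounts for the factor 15. *)
Lemma cc_dist_le p q : (cc_dist p q <= (`|q.1.1 - p.1.1| + `|q.1.2 - p.1.2| +
   15 * Num.sqrt `|q.2 - p.2 - 2 * (q.1.1 * p.1.2 - p.1.1 * q.1.2)|)%:E)%E.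
Proof.
move: p q => [[x y] t] [[x' y'] t'] /=.
set sigma := (X in Num.sqrt `|X|).
pose k := Num.sqrt (35 / 2 * `|sigma|).
have k0 : 0 <= k by exact: sqrtr_ge0.
have kk : 2 / 35 * (k * (Num.sg sigma * k)) = sigma.
  have k2 : k ^+ 2 = 35 / 2 * `|sigma|.
    by rewrite sqr_sqrtr//; have := normr_ge0 sigma; lra.
  transitivity (2 / 35 * k ^+ 2 * Num.sg sigma); first by ring.
  by rewrite k2 [RHS]numEsg; field.
have kle : k <= 5 * Num.sqrt `|sigma|.
  have -> : 5 = Num.sqrt (5 ^+ 2) :> R by rewrite sqrtr_sqr ger0_norm.
  rewrite /k -sqrtrM ?sqr_ge0//.
  by rewrite ler_wsqrtr// ler_wpM2r//; lra.
have := cc_dist_bump_le x y t (x' - x) (y' - y) k (Num.sg sigma * k).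
rewrite kk !(addrC x, addrC y) !subrK.
have -> : t + 2 * (y * (x' - x) - x * (y' - y)) + sigma = t' by rewrite /sigma; ring.
move=> /le_trans; apply; rewrite lee_fin.
have nB : `|Num.sg sigma * k| <= k.
  by rewrite normrM (ger0_norm k0) ler_piMl// normr_sg; case: eqP.
rewrite (ger0_norm k0); lra.
Qed.
End explicit_horizontal_curves.

(** * The labyrinth *)

(* A layer of level [n] contains [48 * 3 ^ n.+1 + 4] layers of level [n.+1]; moving
   by a quarter of [period n.+1] between two of them costs a length of at least
   [period n.+1 / 48], so that doing so for all of them costs more than 1. The
   exponent [m.+2] makes layers so thin that the levels contribute nothing to the
   dimension of the projection to the first coordinate. *)
Fixpoint grid_den (n : nat) : nat :=
  if n is m.+1 then (grid_den m ^ m.+2 * (48 * 3 ^ m.+1 + 4))%N else 4%N.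

Section labyrinth.
Context {R : realType}.
Implicit Types (n j : nat) (p q : heis R) (c : R).

Definition grid n : R := (grid_den n)%:R^-1.
Definition width n : R := grid n ^+ n.+2.
Definition period n : R := (3 ^+ n)^-1.
(* The factor [2 ^+ n] makes the slits of all levels leave a set of positive
   measure in [0, 1]. *)
Definition gap n : R := period n / (24 * 2 ^+ n).

Definition slits n (b : bool) : set R :=
  [set c | exists i : int, `|c - (i%:~R + b%:R / 2) * period n| < gap n].

Definition layer n j : set R := [set x | grid n * j%:R <= x <= grid n * j%:R + width n].

Definition coord n p : R := if odd n then p.2 else p.1.2.

(* Levels cut [y] and [t] alternately; within a level, the parity of the layer
   decides which of the two interleaved families of slits is removed. *)
Definition level n : set (heis R) :=
  [set p | exists2 j : nat, layer n j p.1.1 & ~ slits n (odd j) (coord n p)].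

Definition unit_box : set (heis R) := (`[0, 1] `*` `[0, 1]) `*` `[0, 1].

Definition labyrinth : set (heis R) := unit_box `&` \bigcap_n level n.

(** * Comparison of the scales *)

Lemma grid_den_gt n : (3 ^ n < grid_den n)%N.
Proof.
elim: n => // n IHn /=.
have : (0 < grid_den n ^ n.+2)%N by rewrite expn_gt0; lia.
nia.
Qed.

Lemma grid_den_ge4 n : (4 <= grid_den n)%N.
Proof.
case: n => // n /=.
have : (0 < grid_den n ^ n.+2)%N by rewrite expn_gt0; have := grid_den_gt n; lia.
nia.
Qed.

Lemma grid_gt0 n : 0 < grid n.
Proof. by rewrite invr_gt0 ltr0n; have := grid_den_ge4 n; lia. Qed.

Lemma width_gt0 n : 0 < width n.
Proof. by rewrite exprn_gt0 ?grid_gt0. Qed.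

Lemma period_gt0 n : 0 < period n.
Proof. by rewrite invr_gt0 exprn_gt0. Qed.

Lemma gap_gt0 n : 0 < gap n.
Proof. by rewrite divr_gt0 ?period_gt0// mulr_gt0// exprn_gt0. Qed.

Lemma gap_le n : gap n <= period n / 24.
Proof.
rewrite /gap ler_pM2l ?period_gt0// lef_pV2 ?posrE ?mulr_gt0 ?exprn_gt0//.
by rewrite ler_peMr// exprn_ege1// ler1n.
Qed.

Lemma grid_le_period n : grid n <= period n.
Proof.
rewrite /grid /period lef_pV2 ?posrE ?exprn_gt0 ?ltr0n//; last first.
  by have := grid_den_ge4 n; lia.
by rewrite -natrX ler_nat ltnW// grid_den_gt.
Qed.

Lemma grid_le n : grid n <= 1 / 4.
Proof.
by rewrite /grid div1r lef_pV2 ?posrE ?ltr0n//; [rewrite ler_nat grid_den_ge4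
  |have := grid_den_ge4 n; lia].
Qed.

Lemma width_le n : width n <= grid n ^+ 2.
Proof.
have := grid_gt0 n; have := grid_le n => g1 g0.
by rewrite /width ler_wiXn2l//; lra.
Qed.

Lemma width_le_grid n : width n <= grid n / 4.
Proof.
rewrite (le_trans (width_le n))// expr2 ler_pM2l ?grid_gt0//.
by have := grid_le n; lra.
Qed.

Lemma grid_layers n : (48 * 3 ^+ n.+1 + 4) * grid n.+1 = width n.
Proof.
rewrite /width /grid /= natrM natrX natrD natrM natrX invfM mulrCA divff ?mulr1 ?exprVn//.
Qed.

(** Left faces of layers of level [n] are thus grid points of level [n.+1], so the sublayers of a
    layer can be counted from its left face. *)
Lemma grid_refine n : exists k : nat, grid n = grid n.+1 * k%:R.
Proof.
exists (grid_den n ^ n.+1 * (48 * 3 ^ n.+1 + 4))%N.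
rewrite /grid /= expnS -mulnA natrM invfM -mulrA mulVf ?mulr1//.
rewrite pnatr_eq0 muln_eq0 expn_eq0 negb_or; have := grid_den_ge4 n.
have : (0 < 3 ^ n.+1)%N by rewrite expn_gt0.
by case: (grid_den n) => //; lia.
Qed.

Lemma layer_bound n j x : layer n j x -> x <= 1 -> (j <= grid_den n)%N.
Proof.
move=> /andP[jx _] x1.
have := le_trans jx x1; rewrite mulrC ler_pdivrMr ?mul1r ?ler_nat//.
by rewrite ltr0n; have := grid_den_ge4 n; lia.
Qed.

Lemma layer_uniq n j j' x : layer n j x -> layer n j' x -> j = j'.
Proof.
wlog jj' : j j' / (j <= j')%N.
  move=> H h h'; have [/H->//|/ltnW/H h1] := leqP j j'; exact/esym/h1.
move=> /andP[_ xj] /andP[xj' _]; apply/eqP; rewrite eqn_leq jj' /= leqNgt.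
apply/negP; rewrite -(ler_nat R) -natr1 => jj.
have g0 := grid_gt0 n; have := width_le_grid n; nra.
Qed.

(** Centres of slits of opposite families are at least half a period apart, and each slit has radius
    at most a 24th of a period. *)
Lemma slits_far n b c c' : slits n b c -> slits n (~~ b) c' -> period n / 4 < `|c - c'|.
Proof.
move=> [i ic] [i' ic']; have g := gap_le n; have p0 := period_gt0 n.
have : period n / 2 <= `|(i%:~R + b%:R / 2) * period n - (i'%:~R + (~~ b)%:R / 2) * period n|.
  rewrite -mulrBl normrM (gtr0_norm p0) mulrC ler_pM2r//.
  rewrite (_ : _ - _ = (i - i')%:~R + (b%:R - (~~ b)%:R) / 2 :> R); last first.
    by rewrite intrB; ring.
  have half : 0 < 1 / 2 :> R by lra.
  have [k0|k0|k0] := ltgtP 0 (i - i').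
  - have k1 : 1 <= (i - i')%:~R :> R by rewrite -[1]/(1%:~R) ler_int; lia.
    by case: b {ic ic'} => /=; rewrite ger0_norm; lra.
  - have k1 : (i - i')%:~R <= -1 :> R.
      by rewrite -[-1]/((-1)%:~R) ler_int; lia.
    by case: b {ic ic'} => /=; rewrite ltr0_norm; lra.
  - by case: b {ic ic'} => /=; rewrite -k0 add0r ?subr0 ?sub0r ?mulN1r ?normrN ger0_norm; lra.
move: ic ic'; set u := (i%:~R + _) * _; set u' := (i'%:~R + _) * _ => ic ic'.
move=> uu'; have := ler_distD c u u'; have := ler_distD c' c u'.
rewrite (distrC u c); lra.
Qed.

(** * Compactness and total disconnectedness *)

Lemma slits_open n b : open (slits n b).
Proof.
rewrite (_ : slits n b = \bigcup_(i : int) ball ((i%:~R + b%:R / 2) * period n : R) (gap n)).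
  by apply: bigcup_open => i _; exact: ball_open.
apply/seteqP; split=> c.
  by move=> [i H]; exists i => //; rewrite /ball/= distrC.
by move=> [i _]; rewrite /ball/= distrC => H; exists i.
Qed.

Lemma coord_continuous n : continuous (coord n).
Proof. by rewrite /coord; have [_ ? ?] := @heis_coord_continuous R; case: odd. Qed.

(** Only finitely many layers of each level meet the unit box, so that every level can be replaced
    by a finite union of closed sets. *)
Lemma labyrinthE : labyrinth = unit_box `&` \bigcap_n \bigcup_(j in `I_(grid_den n).+1)
  (((fun p => p.1.1) @^-1` layer n j) `&` (coord n @^-1` (~` slits n (odd j)))).
Proof.
apply/seteqP; split=> p [box lev]; split=> // n _; last first.
  by have [j _ [h1 h2]] := lev n I; exists j.
have [j h1 h2] := lev n I; exists j => //=; rewrite ltnS.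
apply: layer_bound h1 _.
by case: box => -[/=]; rewrite in_itv/= => /andP[].
Qed.

Lemma labyrinth_compact : compact labyrinth.
Proof.
have [cx _ _] := @heis_coord_continuous R.
rewrite labyrinthE; apply: compact_closedI.
  by apply: compact_setX; [apply: compact_setX|]; exact: segment_compact.
apply: closed_bigI => n _; apply: closed_bigcup => // j _.
apply: closedI.
  apply: (@preimage_closed _ _ (fun p : heis R => p.1.1)).
    by move=> p _; exact: cx.
  rewrite (_ : layer n j = `[grid n * j%:R, grid n * j%:R + width n]%classic).
    exact: interval_closed.
  by apply/seteqP; split=> x; rewrite /layer /= in_itv.
apply: preimage_closed; first by move=> p _; exact: coord_continuous.
by apply: open_closedC; exact: slits_open.
Qed.

Lemma connected_ivt (C : set (heis R)) (f : heis R -> R) p q c : connected C ->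
  continuous f -> C p -> C q -> f p <= c <= f q -> exists2 r, C r & f r = c.
Proof.
move=> cC cf Cp Cq pcq.
have : connected [set f x | x in C].
  by apply: connected_continuous_connected => //; exact: continuous_subspaceT.
move/connected_intervalP => /(_ (f p) (f q)) H.
have [||r Cr <-] := H _ _ c pcq; [by exists p|by exists q|by exists r].
Qed.

Lemma period_small (e : R) : 0 < e -> exists n0, forall n, (n0 <= n)%N -> period n < e.
Proof.
move=> e0; exists (Num.truncn e^-1) => n n0.
rewrite /period invf_plt ?posrE ?exprn_gt0//.
have : e^-1 < (Num.truncn e^-1).+1%:R by apply: truncnS_gt.
move=> /lt_le_trans; apply; rewrite -natrX ler_nat.
by rewrite (leq_ltn_trans n0)// ltn_expl.
Qed.

Lemma labyrinth_totally_disconnected : totally_disconnected labyrinth.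
Proof.
have [cx cy ct] := @heis_coord_continuous R.
move=> p Ap; apply/seteqP; split=> [q|_ ->]; last exact: connected_component_refl.
move=> [C [Cp CA cC] Cq] /=.
(* If [x] varied by more than a grid step of some level, it would take the value halfway between two
   consecutive left faces, which is in no layer because [width n <= grid n / 4]. *)
have xE r s : C r -> C s -> s.1.1 <= r.1.1.
  move=> Cr Cs; rewrite leNgt; apply/negP => rs.
  have [|n0 Hn] := @period_small (s.1.1 - r.1.1); first by rewrite subr_gt0.
  pose n := n0; have /(le_lt_trans (grid_le_period _)) gn := Hn n (leqnn _).
  have [j jr _] := (CA _ Cr).2 n I.
  have g0 := grid_gt0 n; have wg := width_le_grid n.
  have [|u Cu ux] := @connected_ivt C _ r s (grid n * (j%:R + 1 / 2)) cC cx Cr Cs.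
    move: jr => /andP[? ?]; lra.
  have [j' /andP[]] := (CA _ Cu).2 n I.
  rewrite ux => h1 h2 _.
  have : (j' <= j)%N by rewrite -ltnS -(ltr_nat R) -natr1; nra.
  have : (j < j'.+1)%N by rewrite -(ltr_nat R) -natr1; nra.
  rewrite ltnS => h3 h4; have jj : j = j' by apply/eqP; rewrite eqn_leq h3.
  move: h2; rewrite -jj; nra.
have xC r : C r -> r.1.1 = p.1.1.
  by move=> Cr; apply/le_anti; rewrite !xE.
(* As [x] is constant on [C], only one layer of level [n] is involved, hence only one family of
   slits. A variation larger than a period would reach [c], the first slit centre at or above
   [coord n r]. *)
have coordE n r s : C r -> C s -> coord n s <= coord n r + period n.
  move=> Cr Cs; rewrite leNgt; apply/negP => rs.
  have [j jp _] := (CA _ Cp).2 n I.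
  have p0 := period_gt0 n; have g0 := gap_gt0 n.
  pose i := Num.ceil (coord n r / period n - (odd j)%:R / 2).
  pose c := (i%:~R + (odd j)%:R / 2) * period n.
  have [|u Cu uc] := @connected_ivt C _ r s c cC (@coord_continuous n) Cr Cs.
    have := ceil_itv (coord n r / period n - (odd j)%:R / 2).
    rewrite -/i intrB ltrBlDr lerBlDr => /andP[i1].
    rewrite ler_pdivrMr// => i2; rewrite i2 /=.
    apply: le_trans (ltW rs).
    have : (i%:~R + (odd j)%:R / 2 - 1) * period n <= coord n r; last by rewrite /c; lra.
    by rewrite -ler_pdivlMr//; lra.
  have [j' j'u] := (CA _ Cu).2 n I; apply.
  move: (j'u); rewrite xC// => j'p; rewrite -(layer_uniq jp j'p) uc.
  by exists i; rewrite subrr normr0.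
have yE r s : C r -> C s -> s.1.2 <= r.1.2.
  move=> Cr Cs; apply/ler_addgt0Pr => e e0.
  have [n Hn] := period_small e0; have ne : period n.*2 < e by apply: Hn; lia.
  have := coordE n.*2 _ _ Cr Cs; rewrite /coord odd_double; lra.
have tE r s : C r -> C s -> s.2 <= r.2.
  move=> Cr Cs; apply/ler_addgt0Pr => e e0.
  have [n Hn] := period_small e0; have ne : period n.*2.+1 < e by apply: Hn; lia.
  have := coordE n.*2.+1 _ _ Cr Cs; rewrite /coord /= odd_double /=; lra.
have := xC _ Cq; have := yE _ _ Cq Cp; have := yE _ _ Cp Cq; have := tE _ _ Cq Cp; have := tE _ _ Cp Cq.
case: (p) (q) => [[x y] t] [[x' y'] t'] /= h1 h2 h3 h4 ->.
by congr (_, _, _); apply/le_anti/andP.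
Qed.
End labyrinth.

(** * Curves crossing the labyrinth *)

Section crossing.
Context {R : realType}.
Implicit Types (a b s t r : R) (f : R -> R).

(** * Passage times of continuous functions *)

Definition continuous_itv s t f := forall r, s <= r <= t -> forall e, 0 < e ->
  exists2 d, 0 < d & forall r', s <= r' <= t -> `|r' - r| < d -> `|f r' - f r| < e.

Lemma continuous_itvS s t s' t' f : s <= s' -> t' <= t ->
  continuous_itv s t f -> continuous_itv s' t' f.
Proof.
move=> ss' tt' cf r /andP[sr rt] e e0.
have [|d d0 H] := cf r _ e e0; first by rewrite (le_trans ss' sr) (le_trans rt tt').
exists d => // r' /andP[sr' rt']; apply: H.
by rewrite (le_trans ss' sr') (le_trans rt' tt').
Qed.

Lemma last_passage s t f (c : R) : continuous_itv s t f -> s <= t ->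
  f s <= c <= f t ->
  exists r, [/\ s <= r <= t, f r = c & forall r', r < r' <= t -> c < f r'].
Proof.
move=> cf st /andP[fs ft].
pose S := [set r | s <= r <= t /\ f r <= c].
have Ss : S s by split=> //; rewrite lexx.
have supS : has_sup S by split; [exists s|exists t => x [/andP[]]].
have sS : s <= sup S by apply: sup_upper_bound.
have St : sup S <= t by apply: sup_le_ub => //; [exists s|move=> x [/andP[]]].
have SS : s <= sup S <= t by rewrite sS.
have after r' : sup S < r' <= t -> c < f r'.
  move=> /andP[Sr' r't]; rewrite ltNge; apply/negP => fr'.
  suff : r' <= sup S by rewrite leNgt Sr'.
  by apply: sup_upper_bound => //; split=> //; rewrite r't (le_trans sS (ltW Sr')).
exists (sup S); split => //; apply/eqP; rewrite eq_le; apply/andP; split.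
  rewrite leNgt; apply/negP => cS.
  have [|d d0 H] := cf _ SS (f (sup S) - c); first by rewrite subr_gt0.
  have [x [xst fx] Sx] := sup_adherent d0 supS.
  have xS : x <= sup S by exact: sup_upper_bound.
  have := H x xst; rewrite distrC ger0_norm ?subr_ge0//.
  by move=> /(_ (ltac:(lra))); rewrite ltr_norml; lra.
rewrite leNgt; apply/negP => Sc.
have St' : sup S < t by rewrite lt_neqAle St andbT; apply/eqP => E; rewrite -E in ft; lra.
have [|d d0 H] := cf _ SS (c - f (sup S)); first by rewrite subr_gt0.
pose r' := Num.min t (sup S + d / 2).
have r'1 : sup S < r' by rewrite /r' lt_min St' /=; lra.
have r't : r' <= t by rewrite /r' ge_min lexx.
have r'd : r' <= sup S + d / 2 by rewrite /r' ge_min lexx orbT.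
have := H r'; rewrite r't (le_trans sS (ltW r'1)) => /(_ isT).
rewrite ger0_norm ?subr_ge0 ?(ltW r'1)// => /(_ (ltac:(lra))).
have := after r'; rewrite r'1 r't => /(_ isT).
rewrite ltr_norml; lra.
Qed.

(** This is the last passage of [- f (- r)] at [- c], with time reversed. *)
Lemma first_passage s t f (c : R) : continuous_itv s t f -> s <= t ->
  f s <= c <= f t ->
  exists r, [/\ s <= r <= t, f r = c & forall r', s <= r' < r -> f r' < c].
Proof.
move=> cf st fc.
have [| | |r [rts fr H]] := @last_passage (- t) (- s) (fun r => - f (- r)) (- c).
- move=> r rts e e0; have [|d d0 H] := cf (- r) _ e e0; first by lra.
  exists d => // r' r'ts r'r.
  by rewrite -opprD normrN H//; [lra|rewrite -opprD normrN].
- by rewrite lerN2.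
- by rewrite !opprK; lra.
exists (- r); split; [lra|by rewrite -[LHS]opprK fr opprK|].
move=> r' r'r; have := H (- r'); rewrite opprK ltrN2; apply; lra.
Qed.

(* Both passages are extremal: the crossing of [[c1, c2]] ends at the first visit
   to [c2], so that crossings of successive intervals come one after the other. *)
Lemma crossing s t f (c1 c2 : R) : continuous_itv s t f -> s <= t ->
  f s <= c1 -> c1 < c2 -> c2 <= f t ->
  exists s' t', [/\ s <= s', s' <= t' <= t, f s' = c1 /\ f t' = c2,
    forall r, s' <= r <= t' -> c1 <= f r <= c2 &
    forall r, s <= r < t' -> f r < c2].
Proof.
move=> cf st fs c12 ft.
have [|t' [/andP[st' t't] ft' before]] := first_passage cf st (c := c2).
  by rewrite ft andbT (le_trans fs (ltW c12)).
have [| |s' [/andP[ss' s't'] fs' after]] := @last_passage s t' f c1 _ st'.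
- exact: continuous_itvS cf.
- by rewrite fs ft' ltW.
exists s', t'; split=> //; first by rewrite s't'.
move=> r /andP[s'r rt']; apply/andP; split.
  by move: s'r; rewrite le_eqVlt => /predU1P[<-|s'r]; rewrite ?fs'// ltW// after// s'r.
move: rt'; rewrite le_eqVlt => /predU1P[->|rt']; rewrite ?ft'// ltW// before//.
by rewrite rt' (le_trans ss' s'r).
Qed.

(** The bound [D <= 1] turns the quadratic term [4 * D ^+ 2] into a linear one, so that [t] too is
    Lipschitz on bounded sets. *)
Lemma cc_dist_coordn (p q : heis R) n (D : R) : D <= 1 -> (cc_dist p q < D%:E)%E ->
  `|coord n q - coord n p| <= (4 + 2 * `|p.1.1| + 2 * `|p.1.2|) * D.
Proof.
move=> D1 /cc_dist_coord[h1 h2 h3].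
have D0 : 0 <= D by exact: le_trans (normr_ge0 _) h1.
have px := normr_ge0 p.1.1; have py := normr_ge0 p.1.2.
rewrite /coord; case: odd; last by rewrite (le_trans h2)// ler_peMl//; lra.
have h4 : `|2 * p.1.2 * (q.1.1 - p.1.1)| <= 2 * `|p.1.2| * D.
  by rewrite normrM ler_pM// normrM ger0_norm.
have h5 : `|2 * p.1.1 * (q.1.2 - p.1.2)| <= 2 * `|p.1.1| * D.
  by rewrite normrM ler_pM// normrM ger0_norm.
have D2 : 4 * D ^+ 2 <= 4 * D by nra.
rewrite !mulrDl; move: h3 h4 h5; rewrite !ler_norml; lra.
Qed.

(** On the box of size 2 the Lipschitz constant is 4 + 4 + 4 = 12; with [D] a 48th of a period this
    prices a jump of a quarter period. *)
Lemma cc_dist_jump (p q : heis R) n (D : R) : 0 < D <= 1 ->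
  `|p.1.1| <= 2 -> `|p.1.2| <= 2 ->
  12 * D < `|coord n p - coord n q| -> (D%:E <= cc_dist p q)%E.
Proof.
move=> /andP[D0 D1] px py; rewrite leNgt => pq; apply/negP => /(cc_dist_coordn n D1).
by apply/negP; rewrite -ltNge distrC (le_lt_trans _ pq)// ler_pM2r//; lra.
Qed.

Lemma curve_length_sum (a b : R) (g : R -> heis R) (n : nat) (r : nat -> R) :
  (forall k, (k < n.+1)%N -> a < r k < b) ->
  (forall k, (k < n)%N -> r k < r k.+1) ->
  (\sum_(0 <= k < n) cc_dist (g (r k)) (g (r k.+1)) <= curve_length cc_dist a b g)%E.
Proof.
move=> rab rinc.
have [L sL nL] : exists2 L, size L = n.+1 & forall x k, (k < n.+1)%N -> nth x L k = r k.
  exists [seq r k | k <- iota 0 n.+1]; first by rewrite size_map size_iota.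
  by move=> x k kn; rewrite (nth_map 0%N) ?size_iota// nth_iota.
(* A partition must end at [b], and its sum starts from [a]; the two extreme terms are dropped as
   nonnegative. *)
pose l := rcons L b.
have pl : itv_partition a b l.
  split; last by rewrite last_rcons.
  rewrite rcons_path; apply/andP; split; last first.
    rewrite (last_nth a) sL /= nL//.
    by have := rab n; rewrite ltnSn => /(_ isT)/andP[].
  apply/(pathP a) => -[|i]; rewrite sL => ni /=; rewrite !nL//; last 2 first.
  - exact: rinc.
  - exact: ltnW.
  by have := rab 0%N; rewrite ltn0Sn => /(_ isT)/andP[].
apply: (@le_trans _ _ (\sum_(0 <= k < size l)
   cc_dist (g (nth b (a :: l) k)) (g (nth b (a :: l) k.+1)))%E); last first.
  by apply: ereal_sup_ubound; exists l.
have sl : size l = n.+2 by rewrite size_rcons sL.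
have nl k : (k < n.+1)%N -> nth b (a :: l) k.+1 = r k.
  by move=> kn; rewrite /= nth_rcons sL kn nL.
rewrite sl big_nat_recl// big_nat_recr//=.
rewrite (le_trans _ (leeDr _ _))// ?cc_dist_ge0// (le_trans _ (leeDl _ _))// ?cc_dist_ge0//.
rewrite le_eqVlt; apply/orP; left; apply/eqP.
apply: eq_big_nat => k /andP[_ kn].
by have := nl k (ltnW kn); have := nl k.+1 kn => /= -> ->.
Qed.

Lemma curve_length_dist (a b : R) (g : R -> heis R) r : a < r <= b ->
  (cc_dist (g a) (g r) <= curve_length cc_dist a b g)%E.
Proof.
(* Partitions are strictly increasing, so [r] cannot be inserted before [b] when they coincide. *)
move=> /andP[ar rb]; have [->|rb'] := eqVneq r b.
  apply: (@le_trans _ _ (\sum_(0 <= k < 1) cc_dist (g (nth b [:: a; b] k)) (g (nth b [:: a; b] k.+1)))%E).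
    by rewrite big_nat1.
  apply: ereal_sup_ubound; exists [:: b] => //; apply: itv_partition1.
  exact: lt_le_trans rb.
apply: (@le_trans _ _ (\sum_(0 <= k < 2) cc_dist (g (nth b [:: a; r; b] k)) (g (nth b [:: a; r; b] k.+1)))%E).
  by rewrite big_nat_recl// leeDl// big_nat1 cc_dist_ge0.
apply: ereal_sup_ubound; exists [:: r; b] => //; split => //=.
by rewrite ar lt_neqAle rb' rb.
Qed.

Lemma curve_in_dist (Z : set (heis R)) a b (g : R -> heis R) r (D : R) :
  curve_in cc_dist Z a b g -> a <= r <= b -> 0 < D ->
  exists2 d, 0 < d & forall r', a <= r' <= b -> `|r' - r| < d ->
    (cc_dist (g r) (g r') < D%:E)%E.
Proof.
move=> cg rab D0; have [_] := cg r rab.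
have N0 : nbhs (0%E : \bar R) [set z : \bar R | (z < D%:E)%E].
  by apply: open_nbhs_nbhs; split; [exact: open_ereal_lt_ereal|rewrite /= lte_fin].
move=> /(_ _ N0) /= /nbhs_ballP[d /= d0 H].
exists d => // r' r'ab r'd; apply: H => //.
by rewrite /ball/= distrC.
Qed.

Lemma curve_in_continuous (Z : set (heis R)) a b (g : R -> heis R) :
  curve_in cc_dist Z a b g ->
  continuous_itv a b (fun r => (g r).1.1) /\
  forall n, continuous_itv a b (fun r => coord n (g r)).
Proof.
move=> cg; split=> [r rab e e0|n r rab e e0].
  have [d d0 H] := curve_in_dist cg rab (ltac:(lra) : 0 < e / 2).
  exists d => // r' r'ab r'd; have [h _ _] := cc_dist_coord (H r' r'ab r'd).
  rewrite (le_lt_trans h)//; lra.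
pose K := 4 + 2 * `|(g r).1.1| + 2 * `|(g r).1.2|.
have K0 : 0 < K by rewrite /K; have := normr_ge0 (g r).1.1; have := normr_ge0 (g r).1.2; lra.
pose D := Num.min 1 (e / (2 * K)).
have D0 : 0 < D by rewrite /D lt_min ltr01 divr_gt0// mulr_gt0.
have D1 : D <= 1 by rewrite /D ge_min lexx.
have De : K * D < e.
  apply: (@le_lt_trans _ _ (e / 2)); last by lra.
  rewrite mulrC -ler_pdivlMr// -mulrA -invfM /D ge_min.
  by rewrite lexx orbT.
have [d d0 H] := curve_in_dist cg rab D0.
exists d => // r' r'ab r'd.
exact: le_lt_trans (cc_dist_coordn n D1 (H r' r'ab r'd)) De.
Qed.

Definition crosses (g : R -> heis R) n j s t :=
  [/\ s <= t, (g s).1.1 = grid n * j%:R, (g t).1.1 = grid n * j%:R + width n &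
    forall r, s <= r <= t -> layer n j (g r).1.1].

Section refine.
Context (Z : set (heis R)) (a b : R) (g : R -> heis R).
Context (cg : curve_in cc_dist Z a b g).
Context (lg : (curve_length cc_dist a b g <= 1)%E).
Context (g2 : forall r, a <= r <= b -> `|(g r).1.1| <= 2 /\ `|(g r).1.2| <= 2).

(* Consecutive sublayers have slits at distance more than a quarter of a period,
   and there are too many sublayers for a curve of length 1 to slip through a slit
   of each of them. *)
Lemma crosses_refine n j s t : a < s -> t < b -> crosses g n j s t ->
  exists j' s' t', [/\ s <= s', t' <= t, crosses g n.+1 j' s' t' &
    forall r, s' <= r <= t' -> ~ slits n.+1 (odd j') (coord n.+1 (g r))].
Proof.
move=> as_ tb [st gs gt gst].
have [k gk] := @grid_refine R n.
have [cx cc] := curve_in_continuous cg.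
(* The layer is [N + 4] grid steps wide, so the sublayers of index less than [N + 2] lie inside
   it. *)
pose N := (48 * 3 ^ n.+1)%N.
have w0 := @width_gt0 R n.+1; have g0 := @grid_gt0 R n.+1.
have wg := @width_le_grid R n.+1.
have NR : N%:R = 48 * 3 ^+ n.+1 :> R by rewrite natrM natrX.
have gl := @grid_layers R n.
pose J i := (j * k + i)%N.
have JR i : grid n.+1 * (J i)%:R = grid n * j%:R + grid n.+1 * i%:R :> R.
  by rewrite /J natrD natrM gk; ring.
have cross i : exists st', (i < N.+2)%N ->
    [/\ s <= st'.1, st'.2 <= t, crosses g n.+1 (J i) st'.1 st'.2 &
      forall r, s <= r < st'.2 -> (g r).1.1 < grid n.+1 * (J i)%:R + width n.+1].
  have [iN|iN] := boolP (i < N.+2)%N; last by exists (s, t).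
  have iN' : i%:R + 1 <= N%:R + 2 :> R by rewrite natr1 -natrD ler_nat addn2.
  have i0 : 0 <= i%:R :> R by [].
  have [|||||s' [t' [ss' /andP[s't' t't] [gs' gt'] inn bef]]] :=
    @crossing s t (fun r => (g r).1.1) (grid n.+1 * (J i)%:R)
      (grid n.+1 * (J i)%:R + width n.+1).
  - by apply: continuous_itvS cx; exact: ltW.
  - exact: st.
  - by rewrite gs JR lerDl mulr_ge0// ltW.
  - by rewrite ltrDl.
  - rewrite gt JR -addrA lerD2l -gl -NR; nra.
  by exists (s', t').
have {cross} [F HF] := choice cross.
apply: contrapT => no.
have slit i : exists r, (i < N.+2)%N ->
    (F i).1 <= r <= (F i).2 /\ slits n.+1 (odd (J i)) (coord n.+1 (g r)).
  have [iN|iN] := boolP (i < N.+2)%N; last by exists 0.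
  have [h1 h2 h3 _] := HF i iN.
  apply: contrapT => no'; apply: no; exists (J i), (F i).1, (F i).2; split => //.
  by move=> r hr hs; apply: no'; exists r.
have {slit} [r Hr] := choice slit.
have rst i : (i < N.+2)%N -> s <= r i <= t.
  move=> iN; have [/andP[r1 r2] _] := Hr i iN; have [h1 h2 _ _] := HF i iN.
  by rewrite (le_trans h1 r1) (le_trans r2 h2).
have jump i : (i.+1 < N.+2)%N ->
    period n.+1 / 4 < `|coord n.+1 (g (r i)) - coord n.+1 (g (r i.+1))|.
  move=> iN; have [_ s1] := Hr i (ltnW iN); have [_] := Hr i.+1 iN.
  have -> : odd (J i.+1) = ~~ odd (J i) by rewrite /J addnS.
  exact: slits_far.
(* The crossing of sublayer [i] ends at the first visit to its right face, before the curve can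
   reach the next sublayer; equality is excluded by the jump. *)
have rinc i : (i.+1 < N.+2)%N -> r i < r i.+1.
  move=> iN; rewrite lt_neqAle; apply/andP; split.
    apply/eqP => E; have := jump i iN; rewrite E subrr normr0.
    by have := @period_gt0 R n.+1; lra.
  have [/andP[_ r1] _] := Hr i (ltnW iN); have [/andP[r2 _] _] := Hr i.+1 iN.
  rewrite (le_trans r1)// (le_trans _ r2)// leNgt; apply/negP => lt.
  have [_ _ _ bef] := HF i (ltnW iN); have [h1 _ [_ h2 _ _] _] := HF i.+1 iN.
  have := bef (F i.+1).1; rewrite h1 lt => /(_ isT).
  rewrite h2 !JR -natr1; lra.
have p0 := @period_gt0 R n.+1.
(* The [N + 1] jumps cost at least [period n.+1 / 48] each, while [N] such costs already add up to
   exactly 1. *)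
have : ((N.+1)%:R * (period n.+1 / 48) <= 1 :> R).
  rewrite -lee_fin (le_trans _ lg)// (le_trans _ (@curve_length_sum a b g N.+1 r _ _))//.
  - rewrite -[leLHS]/(((N.+1)%:R * (period n.+1 / 48))%:E).
    rewrite (_ : (_ * _)%R = \sum_(0 <= i < N.+1) (period n.+1 / 48 : R)); last first.
      by rewrite big_const_nat subn0 iter_addr_0 mulr_natl.
    rewrite -sumEFin !big_mkord; apply: lee_sum => -[i iN] _ /=.
    have rab : a <= r i <= b.
      by have /andP[h1 h2] := rst i (ltnW iN); rewrite (le_trans (ltW as_) h1) (le_trans h2 (ltW tb)).
    have [gx gy] := g2 rab.
    apply: (@cc_dist_jump _ _ n.+1) => //; last first.
      by rewrite (le_lt_trans _ (jump i iN))//; lra.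
    rewrite divr_gt0//= ler_pdivrMr// mul1r (@le_trans _ _ 1)// ?ler1n//.
    by rewrite invf_le1 ?exprn_gt0// exprn_ege1// ler1n.
  - move=> i iN; have /andP[h1 h2] := rst i iN.
    by rewrite (lt_le_trans as_ h1) (le_lt_trans h2 tb).
rewrite leNgt => /negP; apply.
have : 3 ^+ n.+1 * period n.+1 = 1 :> R by rewrite divff// gt_eqF// exprn_gt0.
have -> : N.+1%:R = 48 * 3 ^+ n.+1 + 1 :> R by rewrite -NR natr1.
lra.
Qed.

(** Iterated refinement gives nested time intervals, and a common time lies in every level beyond
    [n]. The box and the levels up to [n] come from the hypothesis. *)
Lemma crosses_labyrinth n s t : a < s -> t < b -> crosses g n 0 s t ->
  (forall r, s <= r <= t -> unit_box (g r) /\ forall m, (m <= n)%N -> level m (g r)) ->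
  exists2 r, a <= r <= b & labyrinth (g r).
Proof.
move=> as_ tb cst st.
(* Refinement is available only for actual crossings; it is made a total function so that it can be
   iterated. *)
have [F HF] : {F : nat -> nat * (R * R) -> nat * (R * R) & forall m x,
    a < x.2.1 -> x.2.2 < b -> crosses g m x.1 x.2.1 x.2.2 ->
    let y := F m x in
    [/\ x.2.1 <= y.2.1, y.2.2 <= x.2.2, crosses g m.+1 y.1 y.2.1 y.2.2 &
      forall r, y.2.1 <= r <= y.2.2 -> level m.+1 (g r)]}.
  have /choice[G HG] : forall mx : nat * (nat * (R * R)), exists y : nat * (R * R),
      a < mx.2.2.1 -> mx.2.2.2 < b -> crosses g mx.1 mx.2.1 mx.2.2.1 mx.2.2.2 ->
      [/\ mx.2.2.1 <= y.2.1, y.2.2 <= mx.2.2.2, crosses g mx.1.+1 y.1 y.2.1 y.2.2 &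
        forall r, y.2.1 <= r <= y.2.2 -> level mx.1.+1 (g r)].
    move=> [m [j [s1 t1]]] /=.
    have [H|H] := pselect (a < s1 /\ t1 < b /\ crosses g m j s1 t1); last first.
      by exists (0%N, (0, 0)) => h1 h2 h3; case: H.
    have [h1 [h2 h3]] := H.
    have [j' [s' [t' [k1 k2 k3 k4]]]] := crosses_refine h1 h2 h3.
    exists (j', (s', t')) => _ _ _; split=> // r hr.
    by exists j'; [have [_ _ _] := k3; apply|exact: k4].
  by exists (fun m x => G (m, x)) => m x; exact: (HG (m, x)).
pose S := fix S k := if k is k'.+1 then F (n + k')%N (S k') else (0%N, (s, t)).
have Sab k : [/\ a < (S k).2.1, (S k).2.2 < b & crosses g (n + k)%N (S k).1 (S k).2.1 (S k).2.2].
  elim: k => [|k [h1 h2 h3]]; first by rewrite addn0.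
  have [k1 k2 k3 _] := HF _ _ h1 h2 h3.
  split; [exact: lt_le_trans k1|exact: le_lt_trans h2|by rewrite addnS].
have SS k : [/\ (S k).2.1 <= (S k.+1).2.1, (S k.+1).2.2 <= (S k).2.2 &
    forall r, (S k.+1).2.1 <= r <= (S k.+1).2.2 -> level (n + k).+1 (g r)].
  by have [h1 h2 h3] := Sab k; have [k1 k2 k3 k4] := HF _ _ h1 h2 h3.
have Sst k : (S k).2.1 <= (S k).2.2 by have [_ _ []] := Sab k.
have incr : nondecreasing_seq (fun k => (S k).2.1).
  by apply/nondecreasing_seqP => k; have [] := SS k.
have decr : nonincreasing_seq (fun k => (S k).2.2).
  by apply/nonincreasing_seqP => k; have [] := SS k.
have cross k l : (S k).2.1 <= (S l).2.2.
  by rewrite (le_trans (incr _ _ (leq_maxl k l)))// (le_trans (Sst _))// decr// leq_maxr.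
pose r := sup [set (S k).2.1 | k in setT].
have rS k : (S k).2.1 <= r <= (S k).2.2.
  have E0 : [set (S k).2.1 | k in setT] !=set0 by exists (S 0%N).2.1; exists 0%N.
  have ub l : ubound [set (S k).2.1 | k in setT] (S l).2.2.
    by move=> _ [m _ <-]; exact: cross.
  apply/andP; split; last by apply: sup_le_ub.
  by apply: sup_upper_bound; [split => //; exists (S 0%N).2.2|exists k].
have [box lev] := st r (rS 0%N).
exists r; first by have := rS 0%N; have [/=] := Sab 0%N; lra.
split => // m _; have [/lev//|nm] := leqP m n.
have [_ _] := SS (m - n.+1)%N; rewrite -addnS -subSn// subSS subnKC ?(ltnW nm)//.
by apply; exact: rS.
Qed.
End refine.

(** * Failure of quasiconvexity *)

Lemma width_mono m n : (m <= n)%N -> width n <= width m :> R.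
Proof.
apply: (@homo_leq _ (@width R) (fun x y => y <= x)) => [x//|x y z h1 h2|k].
  exact: le_trans h2 h1.
rewrite (le_trans (width_le_grid _))// -grid_layers.
have := @grid_gt0 R k.+1; have : 0 <= 3 ^+ k.+1 :> R by rewrite exprn_ge0.
nra.
Qed.

(** As [3 ^ n] is odd, 1/2 is an odd multiple of half a period at every level. It is therefore a
    slit centre of one family and far from the slits of the other, which cut layer 0. *)
Lemma half_slits n : slits n true (1 / 2 : R).
Proof.
exists ((3 ^ n)./2%:Z).
rewrite (_ : (_ + _) * _ = 1 / 2); first by rewrite subrr normr0 gap_gt0.
have p0 : 3 ^+ n != 0 :> R by rewrite gt_eqF// exprn_gt0.
have o3 : odd (3 ^ n) by rewrite oddX orbT.
have : ((3 ^ n)./2%:R * 2 + 1 = 3 ^+ n :> R).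
  rewrite -natrX -{2}(odd_double_half (3 ^ n)) o3 natrD addrC -muln2 natrM.
  by rewrite addrC.
rewrite /period => E.
apply: (mulIf p0); rewrite -mulrA mulVf// mulr1 -E -[_%:~R]/((3 ^ n)./2%:R) /=.
by field.
Qed.

Lemma labyrinth_not_quasiconvex : ~ quasiconvex cc_dist (~` (@labyrinth R)).
Proof.
move=> [c [c1 qc]].
have c0 : 0 < c by exact: lt_le_trans c1.
have K0 : 0 < 288 * c by rewrite pmulr_rgt0 ?ltr0n.
(* Here 288 = 3 * 96: since [width n <= period n ^+ 2], the length bound [L] below is at most a 96th
   of a period. *)
have [|n Hn] := @period_small R (288 * c)^-1; first by rewrite invr_gt0.
have {Hn} pn := Hn n (leqnn n).
have p0 := @period_gt0 R n; have w0 := @width_gt0 R n; have g0 := @grid_gt0 R n.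
have wg := @width_le_grid R n; have g1 := @grid_le R n.
have wp : width n <= period n ^+ 2 :> R.
  by rewrite (le_trans (width_le _))// ler_sqr ?nnegrE ?(ltW g0) ?(ltW p0)// grid_le_period.
have p1 : period n <= 1 :> R.
  by rewrite invf_le1 ?exprn_gt0// exprn_ege1// ler1n.
pose L := 3 * c * width n.
have L0 : 0 < L by apply: mulr_gt0 => //; exact: mulr_gt0.
have Lp : L <= period n / 96.
  have : 288 * c * period n <= 1.
    by rewrite mulrC -(ler_pdivlMr _ _ K0) mul1r ltW.
  rewrite /L => h; nra.
pose l : R := width n.
(* Both points lie on one integral curve of [X]: at [y = 1 / 2], moving [x] by [3 * l] moves [t] by
   [3 * l], so their distance is at most [3 * l]. The first is outside the box, the second between
   layers 0 and 1 of level [n]. *)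
pose u : heis R := (- l, 1 / 2, 1 / 2); pose v : heis R := (2 * l, 1 / 2, 1 / 2 + 3 * l).
have uA : (~` labyrinth) u.
  by move=> [[[/=]]]; rewrite in_itv/=; rewrite /l; lra.
have vA : (~` labyrinth) v.
  move=> [_ /(_ n I)[j /andP[/= j1 j2] _]]; rewrite /l in j1 j2.
  have j0 : (j < 1)%N by rewrite -(ltr_nat R); nra.
  by move: j2; rewrite ltnS leqn0 in j0; rewrite (eqP j0) mulr0 add0r; lra.
have [a [b [g [ab cg gu gv [_ lg]]]]] := qc u v uA vA.
have {}lg : (curve_length cc_dist a b g <= L%:E)%E.
  rewrite (le_trans lg)// /L (_ : 3 * c * width n = c * (3 * width n)); last by ring.
  rewrite EFinM lee_wpmul2l ?lee_fin ?(ltW c0)//.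
  rewrite (le_trans (cc_dist_le _ _))// lee_fin /= /l.
  rewrite [X in Num.sqrt `|X|](_ : _ = 0); last by field.
  rewrite subrr normr0 sqrtr0 mulr0 !addr0 ger0_norm; lra.
(* [2 * L] instead of [L] makes the bound on the distance to [u] strict, and the Lipschitz constant
   at [u] is [5 + 2 * l], less than 12. By the choice of [n], [24 * L] is at most a quarter
   period. *)
have near r : a <= r <= b -> forall m, `|(g r).1.1 - u.1.1| <= 2 * L /\
    `|coord m (g r) - 1 / 2| <= 24 * L.
  move=> /andP[ar rb] m.
  have uE : 1 / 2 = coord m u by rewrite /coord; case: odd.
  have [->|ar'] := eqVneq r a; first by rewrite gu -uE !subrr normr0; lra.
  have dL : (cc_dist u (g r) < (2 * L)%:E)%E.
    rewrite -gu (le_lt_trans (curve_length_dist _ (b := b) _))//.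
      by rewrite rb lt_neqAle eq_sym ar' ar.
    by rewrite (le_lt_trans lg)// lte_fin; lra.
  split; first by have [] := cc_dist_coord dL.
  rewrite uE (le_trans (cc_dist_coordn m _ dL))//; first lra.
  rewrite /u /= normrN (ger0_norm (ltW w0)) ger0_norm; last lra.
  nra.
have lg1 : (curve_length cc_dist a b g <= 1)%E.
  by rewrite (le_trans lg)// lee_fin; lra.
have g2 r : a <= r <= b -> `|(g r).1.1| <= 2 /\ `|(g r).1.2| <= 2.
  move=> /near H; have [h1 h2] := H 0%N; move: h1 h2.
  rewrite /u /= /coord /= /l !ler_norml; lra.
have [cx _] := curve_in_continuous cg.
have [|||s [t [as_ /andP[st tb] [gs gt] gst _]]] := @crossing a b (fun r => (g r).1.1) 0 l cx ab.
- by rewrite gu /u /=; rewrite /l; lra.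
- exact: w0.
- by rewrite gv /v /= /l; lra.
have as' : a < s.
  rewrite lt_neqAle as_ andbT; apply/eqP => E.
  by move: gs; rewrite -E gu /u /= /l; lra.
have tb' : t < b.
  rewrite lt_neqAle tb andbT; apply/eqP => E.
  by move: gt; rewrite E gv /v /= /l; lra.
have cst : crosses g n 0 s t.
  by split; rewrite ?mulr0 ?add0r// => r /gst; rewrite /layer /= mulr0 add0r.
have [|r rab rA] := @crosses_labyrinth _ a b g cg lg1 g2 n s t as' tb' cst; last first.
  by have := cg r; rewrite in_itv /= => /(_ rab)[].
move=> r rst.
have rab : a <= r <= b.
  by move: rst => /andP[sr rt]; rewrite (le_trans as_ sr) (le_trans rt tb).
have xr := gst r rst.
split.
  have [_ y1] := near r rab 0%N; have [_ y2] := near r rab 1%N.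
  move: y1 y2 xr; rewrite /coord /= !ler_norml /l => y1 y2 xr.
  by split; [split|]; rewrite /= in_itv /=; lra.
(* During the crossing of [[0, l]] the curve is in layer 0 of every level up to [n], and too close
   to 1/2 to meet the slits there. *)
move=> m mn; exists 0%N.
  rewrite /layer /= mulr0 add0r; move: xr => /andP[-> /=] /le_trans; apply.
  exact: width_mono.
move=> sl; have := slits_far sl (half_slits m).
rewrite distrC => h.
have [_ h'] := near r rab m; rewrite distrC in h'.
have pm : period n <= period m :> R.
  by rewrite /period lef_pV2 ?posrE ?exprn_gt0// ler_weXn2l// ler1n.
lra.
Qed.
End crossing.

(** * Hausdorff dimension *)

Section hausdorff_dimension.
Context {R : realType} {T : Type}.
Context (d : T -> T -> \bar R) (d_ge0 : forall x y, (0 <= d x y)%E).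
Implicit Types (A U : set T) (s delta rho : R).
Local Open Scope ereal_scope.

Lemma diameter_pow_ge0 s U : 0 <= diameter_pow d s U.
Proof. by rewrite /diameter_pow; case: ifP => // _; exact: poweR_ge0. Qed.

Lemma diameter_ge0 U : U !=set0 -> 0 <= diameter d U.
Proof.
move=> [x Ux]; rewrite (le_trans (d_ge0 x x))//.
by apply: ereal_sup_ubound; exists (x, x).
Qed.

Lemma hausdorff_premeasure_ge0 s delta A : 0 <= hausdorff_premeasure d s delta A.
Proof.
apply: le_ereal_inf_tmp => _ [U _ <-].
by apply: nneseries_ge0 => i _ _; exact: diameter_pow_ge0.
Qed.

Lemma hausdorff_measure_eq0 s A :
  (forall delta e, (0 < delta)%R -> (0 < e)%R ->
    hausdorff_premeasure d s delta A <= e%:E) ->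
  hausdorff_measure d s A = 0.
Proof.
move=> H; apply/eqP; rewrite eq_le; apply/andP; split.
  apply: ge_ereal_sup => _ [delta /= delta0 <-].
  by apply/lee_addgt0Pr => e e0; rewrite add0e; exact: H.
apply: (le_trans (hausdorff_premeasure_ge0 s 1 A)).
by apply: ereal_sup_ubound; exists 1%R => //=; exact: ltr01.
Qed.

Lemma diameter_pow_le s U rho : (0 <= s)%R -> U !=set0 -> diameter d U <= rho%:E ->
  diameter_pow d s U <= (rho `^ s)%:E.
Proof.
move=> s0 U0 Urho; rewrite /diameter_pow; case: ifPn => [/eqP U0'|_].
  by move: U0; rewrite U0' => -[].
have D0 := diameter_ge0 U0.
have Dfin : diameter d U \is a fin_num by rewrite ge0_fin_numE// (le_lt_trans Urho)// ltry.
rewrite -(fineK Dfin) poweR_EFin lee_fin ge0_ler_powR// ?nnegrE ?fine_ge0//.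
  by rewrite -lee_fin (le_trans D0).
by rewrite -lee_fin fineK.
Qed.

Lemma hausdorff_premeasure_finite_cover (I : finType) (P : I -> set T) s delta rho A :
  (0 <= s)%R -> (rho <= delta)%R -> A `<=` \bigcup_i P i ->
  (forall i, diameter d (P i) <= rho%:E) ->
  hausdorff_premeasure d s delta A <= (#|I|%:R * rho `^ s)%:E.
Proof.
move=> s0 rd AP Prho.
(* The finite family is enumerated and continued by empty sets, which contribute 0. *)
pose U k := if @insub nat (fun k => k < #|I|)%N _ k is Some i then P (enum_val i) else set0.
have Urho k : diameter d (U k) <= rho%:E.
  rewrite /U; case: insubP => // _; rewrite /diameter setX0 image_set0 ereal_sup0.
  exact: leNye.
have Upow k : diameter_pow d s (U k) <= (rho `^ s)%:E.
  have [U0|/set0P/diameter_pow_le] := eqVneq (U k) set0; last exact.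
  by rewrite /diameter_pow U0 eqxx lee_fin powR_ge0.
apply: (@le_trans _ _ (\sum_(k <oo) diameter_pow d s (U k))).
  apply: ereal_inf_lbound; exists U => //; split=> [x /AP[i _ Pix]|k].
    exists (enum_rank i) => //; rewrite /U insubT//= => lt.
    by rewrite (_ : Sub _ _ = enum_rank i) ?enum_rankK//; exact/val_inj.
  by rewrite (le_trans (Urho k))// lee_fin.
rewrite (nneseries_split 0 #|I|); last by move=> k _; exact: diameter_pow_ge0.
rewrite add0n [X in _ + X]eseries0; last first.
  move=> k kI _; rewrite /U insubF ?ltnNge ?kI//.
  by rewrite /diameter_pow eqxx.
rewrite adde0 (@le_trans _ _ (\sum_(0 <= k < #|I|) (rho `^ s)%:E))//.
  by apply: lee_sum => k _; exact: Upow.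
by rewrite sumEFin sumr_const_nat subn0 mulr_natl.
Qed.
End hausdorff_dimension.

(** * Dimension at most 3: counting tiles *)

Section dimension_upper_bound.
Context {R : realType}.
Implicit Types (n : nat) (p q : heis R) (s : R).

Lemma truncn_itv_scaled (x l : R) : 0 <= x -> 0 < l ->
  (Num.truncn (x / l))%:R * l <= x <= ((Num.truncn (x / l))%:R + 1) * l.
Proof.
move=> x0 l0; have xl : 0 <= x / l by rewrite divr_ge0// ltW.
apply/andP; split; first by rewrite -ler_pdivlMr// truncn_le// ?xl.
by rewrite -ler_pdivrMr// natr1 ltW// truncnS_gt.
Qed.

(* The last condition bounds the vertical coordinate after left translation of
   [(grid n * j, i * width n, _)] to the origin, shifted by 2 to be nonnegative. *)
Definition tile n (j i k : nat) : set (heis R) := [set p |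
  [/\ layer n j p.1.1, i%:R * width n <= p.1.2 <= (i%:R + 1) * width n &
   k%:R * width n ^+ 2 <= p.2 + 2 * (grid n * j%:R) * p.1.2 - 2 * (i%:R * width n) * p.1.1 + 2
     <= (k%:R + 1) * width n ^+ 2]].

(** After translation, vertical coordinates in a tile differ by at most [w ^+ 2], and two products
    of horizontal offsets in [[0, w]] change this to at most [3 * w ^+ 2]. The root is below
    [2 * w], and [w + w + 15 * (2 * w) = 32 * w]. *)
Lemma diameter_tile n j i k : (diameter cc_dist (tile n j i k) <= (32 * width n)%:E)%E.
Proof.
apply: ge_ereal_sup => _ [[p q] [/= [px py pt] [qx qy qt]] <-].
rewrite (le_trans (cc_dist_le _ _))// lee_fin.
move: px qx => /andP[px1 px2] /andP[qx1 qx2].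
have w0 := @width_gt0 R n; set w := width n in px2 qx2 w0 py qy pt qt *.
set x0 := grid n * j%:R in px1 px2 qx1 qx2 pt qt.
set y0 := i%:R * w in py qy pt qt.
have y1 : (i%:R + 1) * w = y0 + w by rewrite /y0; ring.
rewrite y1 in py qy.
have hx : `|q.1.1 - p.1.1| <= w by rewrite ler_norml; lra.
have hy : `|q.1.2 - p.1.2| <= w by rewrite ler_norml; lra.
have hs : Num.sqrt `|q.2 - p.2 - 2 * (q.1.1 * p.1.2 - p.1.1 * q.1.2)| <= 2 * w.
  have -> : 2 * w = Num.sqrt ((2 * w) ^+ 2) by rewrite sqrtr_sqr ger0_norm//; lra.
  rewrite ler_wsqrtr//.
  have k1 : (k%:R + 1) * w ^+ 2 = k%:R * w ^+ 2 + w ^+ 2 by ring.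
  rewrite k1 in pt qt.
  set a := p.1.1 in px1 px2 pt *; set a' := q.1.1 in qx1 qx2 qt *.
  set b := p.1.2 in py pt *; set b' := q.1.2 in qy qt *.
  have -> : q.2 - p.2 - 2 * (a' * b - a * b') =
    (q.2 + 2 * x0 * b' - 2 * y0 * a' + 2) - (p.2 + 2 * x0 * b - 2 * y0 * a + 2)
    - 2 * ((a' - x0) * (b - y0) - (a - x0) * (b' - y0)) by ring.
  have sq z z' : 0 <= z <= w -> 0 <= z' <= w -> 0 <= z * z' <= w ^+ 2.
    by move=> /andP[z0 zw] /andP[z0' zw']; rewrite mulr_ge0 ?expr2 ?ler_pM.
  have h1 : 0 <= (a' - x0) * (b - y0) <= w ^+ 2 by apply: sq; lra.
  have h2 : 0 <= (a - x0) * (b' - y0) <= w ^+ 2 by apply: sq; lra.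
  rewrite exprMn ler_norml; lra.
lra.
Qed.

(** With [W] and [L] the inverses of [grid n] and [width n], at most [2 * W] layers, [2 * L] strips
    in [y] and [6 * L ^ 2] vertical slabs are needed: on the unit box the shifted vertical
    coordinate [tau] lies in [[0, 5]]. *)
Lemma labyrinth_tiles n : exists I : finType, exists P : I -> set (heis R),
  [/\ #|I|%:R <= 24 * (grid n * width n ^+ 3)^-1 :> R, labyrinth `<=` \bigcup_i P i &
    forall i, (diameter cc_dist (P i) <= (32 * width n)%:E)%E].
Proof.
pose W := grid_den n; pose L := (W ^ n.+2)%N.
have w0 := @width_gt0 R n; have g0 := @grid_gt0 R n.
have W4 : (4 <= W)%N := grid_den_ge4 n.
have L1 : (1 <= L)%N by rewrite expn_gt0; lia.
have wL : width n = L%:R^-1 :> R by rewrite /width /grid /L natrX exprVn.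
exists ('I_W.+1 * ('I_L.+1 * 'I_(5 * L ^ 2).+1))%type.
exists (fun i : 'I_W.+1 * ('I_L.+1 * 'I_(5 * L ^ 2).+1) => tile n i.1 i.2.1 i.2.2); split.
- rewrite !card_prod !card_ord wL /grid -/W !exprVn -invfM invrK -natrX -!natrM ler_nat.
  rewrite [leqRHS](_ : _ = 2 * W * (2 * L * (6 * L ^ 2)))%N; last by lia.
  by rewrite !leq_mul//; nia.
- move=> p [[[/=]]]; rewrite !in_itv/= => /andP[x0 x1] /andP[y0 y1] /andP[t0 t1].
  move=> /(_ n I)[j jx _].
  have jW : (j < W.+1)%N by rewrite ltnS; exact: layer_bound jx x1.
  set i := Num.truncn (p.1.2 / width n).
  have iw := truncn_itv_scaled y0 w0; rewrite -/i in iw.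
  have iL : (i < L.+1)%N.
    rewrite ltnS -(ler_nat R) (@le_trans _ _ (p.1.2 / width n))//.
      by rewrite truncn_le// divr_ge0// ltW.
    by rewrite wL invrK ler_piMl.
  set tau := p.2 + 2 * (grid n * j%:R) * p.1.2 - 2 * (i%:R * width n) * p.1.1 + 2.
  have jx1 : grid n * j%:R <= 1 :> R by case/andP: jx => h _; exact: le_trans x1.
  have jx0 : 0 <= grid n * j%:R :> R by rewrite mulr_ge0// ltW.
  have iw1 : i%:R * width n <= 1 :> R by case/andP: iw => h _; exact: le_trans y1.
  have iw0 : 0 <= i%:R * width n :> R by rewrite mulr_ge0// ltW.
  have h1 : 0 <= (grid n * j%:R) * p.1.2 <= 1 by rewrite mulr_ge0// mulr_ile1.
  have h2 : 0 <= (i%:R * width n) * p.1.1 <= 1 by rewrite mulr_ge0// mulr_ile1.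
  have tau0 : 0 <= tau by rewrite /tau; lra.
  have tau5 : tau <= 5 by rewrite /tau; lra.
  have w20 : 0 < width n ^+ 2 :> R by rewrite exprn_gt0.
  set k := Num.truncn (tau / width n ^+ 2).
  have kw := truncn_itv_scaled tau0 w20; rewrite -/k in kw.
  have kL : (k < (5 * L ^ 2).+1)%N.
    rewrite ltnS -(ler_nat R) (@le_trans _ _ (tau / width n ^+ 2))//.
      by rewrite truncn_le// divr_ge0// ltW.
    by rewrite wL exprVn invrK natrM natrX ler_wpM2r// exprn_ge0.
  by exists (Ordinal jW, (Ordinal iL, Ordinal kL)).
- by move=> i; exact: diameter_tile.
Qed.

(** The tiles of level [n] contribute at most [K / grid n * width n ^ (s - 3)]. As
    [width n = grid n ^+ n.+2], the last factor is at most [grid n ^+ 2] once [n.+2 * (s - 3) >= 2],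
    which leaves [K * grid n]. *)
Lemma labyrinth_hausdorff_measure_eq0 s : 3 < s ->
  hausdorff_measure cc_dist s (@labyrinth R) = 0%E.
Proof.
move=> s3; apply: hausdorff_measure_eq0.
move=> delta e delta0 e0.
pose K : R := 24 * 32 `^ s.
have K0 : 0 < K by rewrite mulr_gt0 ?powR_gt0.
have [n1 Hn1] := @period_small R (e / K) (divr_gt0 e0 K0).
have [n2 Hn2] := @period_small R (delta / 32) (divr_gt0 delta0 (ltr0n _ 32)).
pose n3 := Num.truncn (2 / (s - 3)).
pose n := (n1 + n2 + n3)%N.
have n1n : (n1 <= n)%N by rewrite /n -addnA leq_addr.
have n2n : (n2 <= n)%N by rewrite /n addnAC leq_addl.
have pn1 := Hn1 n n1n; have pn2 := Hn2 n n2n.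
have w0 := @width_gt0 R n; have g0 := @grid_gt0 R n; have gp := @grid_le_period R n.
have g1 : grid n <= 1 :> R by rewrite (le_trans (grid_le _))//; lra.
have [I [P [cI AP Pw]]] := labyrinth_tiles n.
apply: (le_trans (hausdorff_premeasure_finite_cover (@cc_dist_ge0 R) _ _ AP Pw)).
- by lra.
- rewrite mulrC -ler_pdivlMr ?ltr0n// (le_trans (width_le_grid _))//.
  rewrite (le_trans _ (ltW pn2))// (le_trans _ gp)//.
  by lra.
have n3s : 2 <= n.+2%:R * (s - 3).
  rewrite -ler_pdivrMr; last by rewrite subr_gt0.
  rewrite (@le_trans _ _ n3.+1%:R)//; first by rewrite ltW// truncnS_gt.
  by rewrite ler_nat ltnS (leq_trans (leq_addl _ _) (leqnSn _)).
have ws : width n `^ (s - 3) <= grid n ^+ 2 :> R.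
  rewrite /width -powR_mulrn; last exact: ltW.
  rewrite -powRrM -powR_mulrn; last exact: ltW.
  by apply: ger_powR => //; rewrite g0.
have -> : (32 * width n) `^ s = 32 `^ s * (width n ^+ 3 * width n `^ (s - 3)) :> R.
  rewrite powRM ?ltW//; congr (_ * _).
  rewrite -powR_mulrn; last exact: ltW.
  rewrite -powRD; last by rewrite (gt_eqF w0) implybT.
  by congr (_ `^ _); lra.
rewrite lee_fin.
apply: (@le_trans _ _ (K * grid n)); last first.
  by rewrite mulrC -ler_pdivlMr// (le_trans gp)// ltW.
have -> : K * grid n = 24 * (grid n * width n ^+ 3)^-1 *
   (32 `^ s * (width n ^+ 3 * grid n ^+ 2)).
  by rewrite /K; field; rewrite !gt_eqF.
apply: ler_pM => //.
  by rewrite mulr_ge0 ?powR_ge0// mulr_ge0 ?powR_ge0// exprn_ge0// ltW.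
by rewrite ler_pM2l ?powR_gt0// ler_pM2l ?exprn_gt0.
Qed.
End dimension_upper_bound.

(** * Dimension at least 3: area of a slice *)

Section dimension_lower_bound.
Context {R : realType}.
Implicit Types (n : nat) (s : R).
Local Notation mu := (@lebesgue_measure R).

(** The plane [x = 0] lies in layer 0 of every level, so only the family [false] matters. Removing
    its slits of all levels makes one set suitable for both [y] and [t]. *)
Definition unslit : set R := `[0, 1]%classic `\` \bigcup_n slits n false.

Lemma measurable_slits n b : measurable (slits n b : set R).
Proof. by apply: open_measurable; exact: slits_open. Qed.

Lemma measurable_unslit : measurable unslit.
Proof.
by apply: measurableD => //; apply: bigcup_measurable => n _; exact: measurable_slits.
Qed.

(** At most [3 ^ n + 1] slits meet the interval, each of length [2 * gap n]. The bound is written as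
    a term of a geometric series of sum 1/3. *)
Lemma measure_slits_le n :
  (mu (slits n false `&` `[0%R, 1%R]) <= (3^-1 / (2 ^ n.+1)%:R)%:E)%E.
Proof.
have p0 := @period_gt0 R n; have gp := @gap_le R n; have g0 := @gap_gt0 R n.
have p3 : 3 ^+ n * period n = 1 :> R by rewrite divff// gt_eqF// exprn_gt0.
pose B (i : nat) : set R := ball (i%:R * period n) (gap n).
apply: (@le_trans _ _ (\sum_(i < (3 ^ n).+1) mu (B i))%E).
  apply: (@content_subadditive _ _ _ mu _ B).
  - by move=> k _; exact: measurable_ball.
  - by apply: measurableI => //; exact: measurable_slits.
  move=> c [[i]]; rewrite mul0r addr0 /= in_itv /= => ic /andP[c0 c1].
  have i0 : 0 <= i.
    rewrite leNgt; apply/negP => i0.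
    have : i%:~R <= -1 :> R by rewrite -[-1]/((-1)%:~R) ler_int; lia.
    move: ic; rewrite ltr_norml => /andP[_ ic] i1; nra.
  case: i i0 ic => // i _; rewrite -[_%:~R]/(i%:R) => ic.
  have i3 : (i < (3 ^ n).+1)%N.
    rewrite ltnS -ltnS -(ltr_nat R) -natr1 natrX -(ltr_pM2r p0) mulrDl p3 mul1r.
    by move: ic; rewrite ltr_norml; lra.
  rewrite -bigcup_mkord; exists i => //.
  by rewrite /B /ball /= distrC.
rewrite (eq_bigr (fun=> (2 * gap n)%:E)); last first.
  by move=> i _; rewrite lebesgue_measure_ball ?ltW// mulr_natl.
rewrite sumEFin lee_fin sumr_const card_ord.
have h3 : 1 <= 3 ^+ n :> R by rewrite exprn_ege1// ler1n.
have h2 : 0 < 2 ^+ n :> R by rewrite exprn_gt0.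
rewrite -[leLHS]mulr_natr natrX exprS.
have -> : (3 ^ n).+1%:R = 3 ^+ n + 1 :> R by rewrite -natrX natr1.
have -> : 3^-1 / (2 * 2 ^+ n) = 4 * 3 ^+ n * gap n :> R.
  rewrite /gap; transitivity (3^-1 / (2 * 2 ^+ n) * ((3 ^+ n * period n) : R)).
    by rewrite p3 mulr1.
  by field; rewrite gt_eqF.
nra.
Qed.

Lemma measure_unslit_ge : ((2 / 3)%:E <= mu unslit)%E.
Proof.
pose S n : set R := slits n false `&` `[0, 1].
have mS n : measurable (S n) by apply: measurableI => //; exact: measurable_slits.
have mbS : measurable (\bigcup_n S n) by apply: bigcup_measurable.
have : (1%:E <= mu unslit + (1 / 3)%:E)%E.
  apply: (@le_trans _ _ (mu unslit + mu (\bigcup_n S n))%E).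
    rewrite (@le_trans _ _ (mu (unslit `|` \bigcup_n S n)))//; last first.
      by apply: measureU2 => //; exact: measurable_unslit.
    rewrite (_ : 1%:E = mu `[0%R, 1%R]); last first.
      by rewrite lebesgue_measure_itv/= lte_fin ltr01 sube0.
    apply: le_measure; rewrite ?inE//.
      by apply: measurableU => //; exact: measurable_unslit.
    move=> c c01; have [[n _ nc]|nc] := pselect ((\bigcup_n slits n false) c).
      by right; exists n.
    by left.
  rewrite leeD2l// (@le_trans _ _ (\sum_(n <oo) mu (S n))%E)//.
    exact: measure_sigma_subadditive.
  have e3 : 0 <= 3^-1 :> R by lra.
  rewrite mul1r; apply: le_trans (epsilon_trick0 xpredT e3).
  by apply: lee_nneseries => // n _; exact: measure_slits_le.
have fu : mu unslit \is a fin_num.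
  rewrite ge0_fin_numE// (@le_lt_trans _ _ (mu `[0%R, 1%R]))//.
    by apply: le_measure; rewrite ?inE//; [exact: measurable_unslit|exact: subDsetl].
  by rewrite lebesgue_measure_itv/= lte_fin ltr01 sube0 ltry.
by rewrite -(fineK fu) -EFinD !lee_fin; lra.
Qed.

Lemma labyrinth_slice (y t : R) : unslit y -> unslit t -> labyrinth (0, y, t).
Proof.
move=> [y01 ys] [t01 ts]; split.
  by split; [split|] => //=; rewrite in_itv/= lexx ler01.
move=> n _; exists 0%N.
  by rewrite /layer/= mulr0 add0r lexx ltW// width_gt0.
by rewrite /coord /=; case: odd => h; [apply: ts|apply: ys]; exists n.
Qed.

(* In the plane [x = 0] a set of diameter [rho] lies in a box of size
   [2 rho * 8 rho ^ 2], so that cc dimension 3 corresponds to area. *)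
Lemma slice_diameter (U : set (heis R)) : (diameter cc_dist U <= 1)%E ->
  exists Q : set (R * R),
    [/\ measurable Q, forall y t, U (0, y, t) -> Q (y, t) &
     forall s, s <= 3 -> ((mu \x mu) Q <= 16%:E * diameter_pow cc_dist s U)%E].
Proof.
move=> dU.
have [[[y0 t0] /= U0]|noU] := pselect (exists z : R * R, U (0, z.1, z.2)); last first.
  exists set0; split=> // [y t Uyt|s s3].
    by apply: noU; exists (y, t).
  by rewrite measure0 mule_ge0// diameter_pow_ge0.
have Une : U !=set0 by exists (0, y0, t0).
have D0 := diameter_ge0 (@cc_dist_ge0 R) Une.
have Dfin : diameter cc_dist U \is a fin_num.
  by rewrite ge0_fin_numE// (le_lt_trans dU)// ltry.
set rho := fine (diameter cc_dist U).
have rhoE : diameter cc_dist U = rho%:E by rewrite fineK.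
have rho0 : 0 <= rho by rewrite fine_ge0.
have rho1 : rho <= 1 by rewrite -lee_fin -rhoE.
exists (`[y0 - rho, y0 + rho] `*` `[t0 - 4 * rho ^+ 2, t0 + 4 * rho ^+ 2]).
split.
- exact: measurableX.
- move=> y t Uyt.
  have dr (e : R) : 0 < e -> (cc_dist (0, y0, t0)%R (0, y, t)%R < (rho + e)%:E)%E.
    move=> e0; rewrite (@le_lt_trans _ _ rho%:E)//; last by rewrite lte_fin ltrDl.
    by rewrite -rhoE; apply: ereal_sup_ubound; exists ((0, y0, t0), (0, y, t)).
  have hy : `|y - y0| <= rho.
    by apply/ler_addgt0Pr => e e0; have [] := cc_dist_coord (dr e e0).
  have ht : `|t - t0| <= 4 * rho ^+ 2.
    (* As [rho] and [e'] are at most 1, [4 * (rho + e') ^ 2] exceeds [4 * rho ^ 2] by at most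
       [12 * e']. *)
    apply/ler_addgt0Pr => e e0.
    pose e' := Num.min 1 (e / 12).
    have e'0 : 0 < e' by rewrite lt_min ltr01 divr_gt0.
    have e'1 : e' <= 1 by rewrite ge_min lexx.
    have e'e : e' <= e / 12 by rewrite ge_min lexx orbT.
    have [_ _ /=] := cc_dist_coord (dr e' e'0).
    rewrite subrr !mulr0 mul0r subr0 addr0 => /le_trans; apply; nra.
  by split; rewrite /= in_itv /=; move: hy ht; rewrite !ler_norml; lra.
- move=> s s3.
  have ms (a b : R) : 0 <= b -> mu `[a - b, a + b] = (2 * b)%:E.
    move=> b0; rewrite lebesgue_measure_itv/= lte_fin; case: ltP => ab.
      by rewrite -EFinB; congr EFin; ring.
    by congr EFin; lra.
  rewrite product_measure1E// [X in (X * _)%E]ms// [X in (_ * X)%E]ms; last first.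
    by rewrite mulr_ge0// sqr_ge0.
  rewrite /diameter_pow ifF; last by apply/negbTE/set0P.
  rewrite rhoE poweR_EFin -!EFinM lee_fin.
  rewrite [leLHS](_ : _ = 16 * rho ^+ 3); last by ring.
  rewrite ler_pM2l ?ltr0n//.
  have [->|r0] := eqVneq rho 0; first by rewrite expr0n /= powR_ge0.
  rewrite -powR_mulrn//; apply: ger_powR => //.
  by rewrite rho1 lt_neqAle eq_sym r0 rho0.
Qed.

(** A cover of total less than 1/64 would trace on the plane [x = 0] sets of total area less than
    16/64, whereas the slice has area at least 4/9. *)
Lemma labyrinth_hausdorff_measure_neq0 s : s < 3 ->
  hausdorff_measure cc_dist s (@labyrinth R) != 0%E.
Proof.
move=> s3; apply/eqP => H0.
have : (hausdorff_premeasure cc_dist s 1 (@labyrinth R) < (64^-1)%:E)%E.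
  rewrite (@le_lt_trans _ _ 0%E) ?lte_fin ?invr_gt0 ?ltr0n//.
  by rewrite -H0; apply: ereal_sup_ubound; exists 1 => //=; exact: ltr01.
move=> /ereal_inf_lt[_ [U [cU dU] <-]] sU.
have /choice[Q HQ] : forall i, exists Q : set (R * R),
    [/\ measurable Q, forall y t, U i (0, y, t) -> Q (y, t) &
     forall s, s <= 3 -> ((mu \x mu) Q <= 16%:E * diameter_pow cc_dist s (U i))%E].
  by move=> i; exact: slice_diameter.
have mQ i : measurable (Q i) by have [] := HQ i.
have : ((4 / 9)%:E <= (mu \x mu) (unslit `*` unslit))%E.
  rewrite product_measure1E; [|exact: measurable_unslit..].
  have -> : (4 / 9)%:E = ((2 / 3)%:E * (2 / 3)%:E)%E :> \bar R.
    by rewrite -EFinM; congr EFin; field.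
  by apply: lee_pmul; rewrite ?measure_unslit_ge// lee_fin; lra.
apply/negP; rewrite -ltNge.
apply: (@le_lt_trans _ _ (\sum_(i <oo) (mu \x mu) (Q i))%E).
  apply: measure_sigma_subadditive => //.
    by apply: measurableX; exact: measurable_unslit.
  move=> [y t] [/= uy ut]; have [i _ Ui] := cU _ (labyrinth_slice uy ut).
  by exists i => //; have [_ + _] := HQ i; apply.
apply: (@le_lt_trans _ _ (16%:E * \sum_(i <oo) diameter_pow cc_dist s (U i))%E).
  rewrite -nneseriesZl; last by move=> i _; exact: diameter_pow_ge0.
  by apply: lee_nneseries => // i _; have [_ _] := HQ i; apply; exact: ltW.
apply: (@le_lt_trans _ _ (16%:E * (64^-1)%:E)%E).
  by apply: lee_wpmul2l; [rewrite lee_fin ler0n|exact: ltW].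
by rewrite -EFinM lte_fin; lra.
Qed.

Lemma labyrinth_hausdorff_dim : hausdorff_dim cc_dist (@labyrinth R) = 3%:E%E.
Proof.
apply/eqP; rewrite eq_le; apply/andP; split.
  apply/lee_addgt0Pr => e e0; apply: ereal_inf_lbound.
  exists (3 + e); last by rewrite EFinD.
  split; first by rewrite addr_ge0// ltW.
  by apply: labyrinth_hausdorff_measure_eq0; rewrite ltrDl.
apply: le_ereal_inf_tmp => _ [s [s0 Hs] <-]; rewrite lee_fin leNgt.
by apply/negP => /labyrinth_hausdorff_measure_neq0; rewrite Hs eqxx.
Qed.
End dimension_lower_bound.

Local Open Scope classical_set_scope.
Local Open Scope ereal_scope.

Theorem theorem1p3 (R : realType) :
  exists A : set (heis R),
    [/\ compact A, totally_disconnected A, hausdorff_dim cc_dist A = 3%:E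
      & ~ quasiconvex cc_dist (~` A)].
Proof.
exists labyrinth; split.
- exact: labyrinth_compact.
- exact: labyrinth_totally_disconnected.
- exact: labyrinth_hausdorff_dim.
- exact: labyrinth_not_quasiconvex.
Qed.
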